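(* (i) If $\Gamma\ne\emptyset$, then $\Gamma\times E\subset\operatorname{supp}(\mu)$ for all $\mu\in\tilde{\mathcal P}_{inv}$, and there exists $\mu\in\tilde{\mathcal P}_{inv}$ such that $\operatorname{supp}(\mu)=\Gamma\times E$. (ii) If $\Gamma$ has non empty interior, then $\Gamma\times E=\operatorname{supp}(\mu)$ for all $\mu\in\tilde{\mathcal P}_{inv}$. (iii) Suppose that $\tilde Z$ is stable (i.e. has a unique invariant probability measure), with invariant probability $\pi$. Then $\operatorname{supp}(\pi)=\Gamma\times E$.
   Context: Setting. Let $d\ge 1$ and let $E$ be a finite set. For each $i\in E$, $F^i:\mathbb R^d\to\mathbb R^d$ is a smooth bounded vector field with flow $\Phi^i=(\Phi^i_t)$, i.e. $t\mapsto \Phi^i_t(x)=\Phi^i(t,x)$ solves $\dot x=F^i(x)$ with value $x$ at time $0$. $M\subset\mathbb R^d$ is a compact set with $\Phi^i_t(M)\subset M$ for all $i\in E$, $t\ge 0$. Rates $\lambda(x,i,j)$ ($x\in M$, $i,j\in E$) are given such that $x\mapsto\lambda(x,i,j)$ is continuous, $\lambda(x,i,j)\ge 0$ for $i\ne j$, $\lambda(x,i,i)=0$, and for each $x\in M$ the matrix $(\lambda(x,i,j))_{i,j}$ is irreducible. Fix $\lambda>\max_{x\in M,i\in E}\sum_{j\ne i}\lambda(x,i,j)$ and put $Q(x,i,j)=\lambda(x,i,j)/\lambda$ for $i\neq j$, $Q(x,i,i)=1-\sum_{j\ne i}Q(x,i,j)>0$. Chain. Let $(U_n)_{n\ge1}$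 be i.i.d. exponential of parameter $\lambda$, and $\tilde Z_0=(\tilde X_0,\tilde Y_0)\in M\times E$ independent of them. Define recursively $\tilde Z_n=(\tilde X_n,\tilde Y_n)$ on $M\times E$ by $\tilde X_{n+1}=\Phi^{\tilde Y_n}(U_{n+1},\tilde X_n)$ and $\mathbb P[\tilde Y_{n+1}=j\mid \tilde X_{n+1},\tilde Y_n=i]=Q(\tilde X_{n+1},i,j)$. $\tilde{\mathcal P}_{inv}$ is the set of invariant probability measures of the Markov chain $\tilde Z$, and $\operatorname{supp}(\mu)$ is the topological support of $\mu$. Accessible set. For $n\ge 1$ let $\mathbb T_n=E^{n+1}\times\mathbb R_+^n$, with elements $(\mathbf i,\mathbf u)=((i_0,\dots,i_n),(u_1,\dots,u_n))$, and $\mathbf\Phi^{\mathbf i}_{\mathbf u}=\Phi^{i_{n-1}}_{u_n}\circ\cdots\circ\Phi^{i_0}_{u_1}$. Let $\gamma^+(x)=\{\mathbf\Phi^{\mathbf i}_{\mathbf u}(x):(\mathbf i,\mathbf u)\in\bigcup_{n\ge 1}\mathbb T_n\}$ and $\Gamma=\bigcap_{x\in M}\overline{\gamma^+(x)}$. *)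

(* Defs.v *)
From HB Require Import structures.
From mathcomp Require Import all_boot all_order all_algebra.
From mathcomp Require Import all_classical all_reals all_analysis.

Set Implicit Arguments.
Unset Strict Implicit.
Unset Printing Implicit Defensive.

Import Order.TTheory GRing.Theory Num.Theory.
Import numFieldNormedType.Exports.

Local Open Scope classical_set_scope.
Local Open Scope ring_scope.

(* The library's measurable types are pointed, so the nonempty finite set of
   regimes carries a base point; nothing below depends on its choice. *)
#[short(type="pointedFinType")]
HB.structure Definition PointedFinite := {T of Finite T & Pointed T}.

Definition state (R : realType) (d : nat) (E : pointedFinType) : Type :=
  ('rV[R]_d * discrete_topology E)%type.

HB.instance Definition _ (R : realType) (d : nat) (E : pointedFinType) :=
  Topological.copy (state R d E) ('rV[R]_d * discrete_topology E)%type.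
HB.instance Definition _ (R : realType) (d : nat) (E : pointedFinType) :=
  Pointed.copy (state R d E) ('rV[R]_d * discrete_topology E)%type.

Fixpoint class_C (R : realType) (V W : normedModType R) (k : nat)
    (f : V -> W) : Prop :=
  if k is k'.+1 then
    (forall x, differentiable f x) /\ (forall v, class_C k' ('D_v f))
  else continuous f.

Definition smooth (R : realType) (V W : normedModType R) (f : V -> W) : Prop :=
  forall k, class_C k f.

Definition is_flow (R : realType) (V : normedModType R) (F : V -> V)
    (Phi : R -> V -> V) : Prop :=
  forall x, Phi 0 x = x /\
    forall t : R, is_derive t 1 (Phi^~ x) (F (Phi t x)).

Definition irreducible_rates (R : realType) (E : finType) (q : E -> E -> R) :
    Prop :=
  forall i j, connect [rel k l | 0 < q k l] i j.

Definition borel (T : ptopologicalType) := g_sigma_algebraType (@open T).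

Definition msupport (R : realType) (T : ptopologicalType)
    (mu : set (borel T) -> \bar R) : set T :=
  [set z | forall U : set T, open_nbhs z U -> (0 < mu U)%E].

Section pdmp.
Context {R : realType} {d : nat} {E : pointedFinType}.

Variables (Phi : E -> R -> 'rV[R]_d -> 'rV[R]_d) (M : set 'rV[R]_d).

(* [zip] drops the last index of [i], which plays no role in the composition. *)
Definition composite_flow (n : nat) (i : n.+1.-tuple E) (u : n.-tuple R)
    (x : 'rV[R]_d) : 'rV[R]_d :=
  foldl (fun y iu => Phi iu.1 iu.2 y) x (zip i u).

Definition gamma_plus (x : 'rV[R]_d) : set 'rV[R]_d :=
  [set y | exists (n : nat) (i : n.+1.-tuple E) (u : n.-tuple R),
    [/\ (1 <= n)%N, (forall k, 0 <= tnth u k) & y = composite_flow i u x]].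

Definition accessible_set : set 'rV[R]_d :=
  \bigcap_(x in M) closure (gamma_plus x).

Variables (rate : 'rV[R]_d -> E -> E -> R) (lambda : R).

Definition jump_prob (x : 'rV[R]_d) (i j : E) : R :=
  if j == i then 1 - \sum_(k | k != i) rate x i k / lambda
  else rate x i j / lambda.

(* Conditional law of $(\tilde X_{n+1}, \tilde Y_{n+1})$ given
   $(\tilde X_n, \tilde Y_n) = z$: integrate over $U_{n+1}$, then draw the new
   regime from [jump_prob] at the new position. *)
Definition chain_kernel (z : state R d E) (A : set (state R d E)) : \bar R :=
  (\int[exponential_prob lambda]_(u in `[0%R, +oo[)
     (\sum_(j : E) jump_prob (Phi z.2 u z.1) z.2 j
                    * \1_A (Phi z.2 u z.1, j : discrete_topology E))%:E)%E.

(* A probability on $M \times E$ is a Borel probability on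
   $\mathbb{R}^d \times E$ giving mass 1 to $M \times E$. *)
Definition invariant_prob (mu : probability (borel (state R d E)) R) : Prop :=
  mu (M `*` setT) = 1%E /\
  forall A : set (borel (state R d E)), measurable A ->
    mu A = (\int[mu]_(z in M `*` setT) chain_kernel z A)%E.

(* Measures of the library are unconstrained off the measurable sets, hence
   uniqueness is stated on measurable sets rather than as Leibniz equality. *)
Definition is_unique_invariant_prob (pi : probability (borel (state R d E)) R) : Prop :=
  invariant_prob pi /\
  forall mu, invariant_prob mu ->
    forall A : set (borel (state R d E)), measurable A -> mu A = pi A.

End pdmp.

(* Main.v *)
(** The transition operator of the chain is Feller, so the support of an invariant
    probability is stable under every move of positive probability. Switching the
    regime without moving (holding time close to 0, irreducibility) and following
    the flow of the current regime (Q(x,i,i) > 0) are such moves: the support has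
    the form S * E with S closed and stable under the flows, so S contains the
    closure of gamma^+(x) for each x in S, hence Gamma. Conversely, a nonempty
    closed set C stable under the flows carries, on C * E, an invariant probability
    (Krylov-Bogoliubov); C = Gamma gives (i), and C = closure of gamma^+(x), for
    every x, gives (iii). For (ii), the part of mu outside Gamma * E is again
    subinvariant: were it nonzero, the same argument would put Gamma * E in its
    support, although it does not charge the interior of Gamma. *)

From HB Require Import structures.
Require Import Defs.
From mathcomp Require Import all_boot all_order all_algebra.
From mathcomp Require Import all_classical all_reals all_analysis.
From mathcomp Require Import measurable_realfun ring lra.

Set Implicit Arguments.
Unset Strict Implicit.
Unset Printing Implicit Defensive.

Import Order.TTheory GRing.Theory Num.Theory.
Import numFieldNormedType.Exports.

Local Open Scope classical_set_scope.
Local Open Scope ring_scope.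

(** * Riesz representation on a compact set *)

(** The flows are given as solutions in time; their continuity in the initial position, on which the
    Feller property rests, has to be derived, and Gronwall's argument on the compact M provides it.
    Krylov-Bogoliubov then calls for a weak limit of Cesaro means. No topology on measures is set
    up: an ultrafilter finer than [\oo] makes the means of all continuous functions converge at
    once, the limit is a positive linear functional, and a Riesz theorem proved by Daniell's method
    turns it into a probability. Invariance is thus known at the start on continuous functions only;
    a monotone class argument carries it to Borel sets, and likewise the measurability of the
    kernel. Rates and flows are controlled on M, so continuity is always relative to M or M * E.
    Finally, propagating the support uses only lower bounds on mass, so a one-sided inequality is
    enough: this lets one argument serve both mu and its restriction to the complement of Gamma * E,
    which is not known beforehand to be invariant. *)

Section within_continuous.
Context {R : realType} {T : topologicalType}.
Implicit Types (K : set T) (f g : T -> R).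

Lemma within_cst K (c : R) : {within K, continuous (fun=> c : R)}.
Proof. by move=> x; exact: cvg_cst. Qed.

Lemma within_add K f g : {within K, continuous f} ->
  {within K, continuous g} -> {within K, continuous (fun x => f x + g x)}.
Proof. by move=> cf cg x; apply: cvgD; [exact: cf|exact: cg]. Qed.

Lemma within_mul K f g : {within K, continuous f} ->
  {within K, continuous g} -> {within K, continuous (fun x => f x * g x)}.
Proof. by move=> cf cg x; apply: cvgM; [exact: cf|exact: cg]. Qed.

Lemma within_min K f g : {within K, continuous f} -> {within K, continuous g} ->
  {within K, continuous (fun x => Num.min (f x) (g x))}.
Proof. by move=> cf cg x; apply: continuous_min; [exact: cf|exact: cg]. Qed.

End within_continuous.
Arguments within_cst {R T K} c.

Lemma closed_borel {T : ptopologicalType} (K : set T) :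
  closed K -> measurable (K : set (borel T)).
Proof.
move=> cK; rewrite -[K]setCK; apply: measurableC.
by apply: sub_sigma_algebra; exact: closed_openC.
Qed.

Lemma within_continuous_measurable {R : realType} {T : ptopologicalType}
    (K : set T) (f : T -> R) : closed K -> {within K, continuous f} ->
  measurable_fun (K : set (borel T)) f.
Proof.
move=> cK cf; apply: (measurability _ (RGenOInfty.measurableE R)).
move=> _ [_ [a ->] <-].
have /open_subspaceP[V oV VK] := (continuousP _).1 cf _ (@open_gt R a).
have -> : K `&` f @^-1` `]a, +oo[ = V `&` K.
  rewrite VK setIC; congr (_ `&` _).
  by apply/seteqP; split=> x /=; rewrite in_itv/= andbT.
apply: measurableI; last exact: closed_borel.
exact: sub_sigma_algebra.
Qed.

Section riesz.
Context {R : realType} {T : ptopologicalType}.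
Variables (K : set T) (L : (T -> R) -> R).
Hypothesis compactK : compact K.
Hypothesis closedK : closed K.
(** Stands in for a metric: the truncated multiples min(1, n f) increase to the indicator of U,
    which is what makes open sets Caratheodory measurable. *)
Hypothesis cozero : forall U : set T, open U ->
  exists f : T -> R, [/\ continuous f, forall x, 0 <= f x & U = [set x | 0 < f x]].

Hypothesis L_add : forall f g : T -> R,
  {within K, continuous f} -> {within K, continuous g} ->
  L (fun x => f x + g x) = L f + L g.
Hypothesis L_scale : forall (c : R) (f : T -> R),
  {within K, continuous f} -> L (fun x => c * f x) = c * L f.
Hypothesis L_mono : forall f g : T -> R,
  {within K, continuous f} -> {within K, continuous g} ->
  (forall x, K x -> f x <= g x) -> L f <= L g.
Hypothesis L_one : L (fun=> 1) = 1.

Let L_zero : L (fun=> 0) = 0.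
Proof.
rewrite -[RHS](mul0r (L (fun=> 1))) -L_scale; last exact: within_cst.
by congr L; apply/funext => x; rewrite mul0r.
Qed.

Let L_ge0 (f : T -> R) : {within K, continuous f} ->
  (forall x, K x -> 0 <= f x) -> 0 <= L f.
Proof. by move=> cf f0; rewrite -L_zero; apply: L_mono => //; exact: within_cst. Qed.

Let L_eq (f g : T -> R) : {within K, continuous f} -> {within K, continuous g} ->
  (forall x, K x -> f x = g x) -> L f = L g.
Proof.
by move=> cf cg fg; apply/eqP; rewrite eq_le !L_mono// => x Kx; rewrite fg.
Qed.

Let L_sum (h : nat -> T -> R) (n : nat) : (forall k, {within K, continuous (h k)}) ->
  {within K, continuous (fun x => \sum_(k < n) h k x)} /\
  L (fun x => \sum_(k < n) h k x) = \sum_(k < n) L (h k).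
Proof.
move=> ch; elim: n => [|n [cS LS]].
  rewrite big_ord0 (_ : (fun x => _) = fun=> 0) ?L_zero; last first.
    by apply/funext => x; rewrite big_ord0.
  by split; first exact: within_cst.
rewrite big_ord_recr/= -LS -L_add//.
rewrite (_ : (fun x => _) = fun x => (\sum_(k < n) h k x) + h n x); last first.
  by apply/funext => x; rewrite big_ord_recr.
by split=> //; exact: within_add.
Qed.

(* Daniell's upper integral of the indicator of A: nondecreasing sequences of
   continuous functions reaching 1 on A; points outside K do not count. *)
Definition upper_approx (A : set T) (h : nat -> T -> R) :=
  [/\ forall n, {within K, continuous (h n)},
      forall n x, K x -> 0 <= h n x,
      forall x, K x -> nondecreasing_seq (h ^~ x) &
      forall x, K x -> A x -> exists n, 1 <= h n x].

Definition daniell_outer (A : set T) : \bar R :=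
  ereal_inf [set c%:E | c in
    [set c | exists2 h, upper_approx A h & forall n, L (h n) <= c]].

Local Notation m := daniell_outer.

Let m_le (A : set T) h c : upper_approx A h -> (forall n, L (h n) <= c) ->
  (m A <= c%:E)%E.
Proof. by move=> hA hc; apply: ereal_inf_lbound; exists c => //; exists h. Qed.

Let m_ge0 A : (0 <= m A)%E.
Proof.
apply: le_ereal_inf_tmp => _ [c [h [ch h0 _ _] hc] <-].
by rewrite lee_fin (le_trans _ (hc 0%N))// L_ge0// => x; exact: h0.
Qed.

Let m_le1 A : (m A <= 1)%E.
Proof.
apply: (@m_le _ (fun _ _ => 1)) => [|n]; last by rewrite L_one.
split=> // [n|x _ n k _|x _ _]; [exact: within_cst|by []|by exists 0%N].
Qed.

Let m_fin A : m A \is a fin_num.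
Proof. by rewrite ge0_fin_numE ?m_ge0// (le_lt_trans (m_le1 A)) ?ltry. Qed.

Let m_near A e : 0 < e -> exists2 c, (c%:E < m A + e%:E)%E &
  exists2 h, upper_approx A h & forall n, L (h n) <= c.
Proof.
move=> e0; have [_ [c cA <-] ce] := lb_ereal_inf_adherent e0 (m_fin A).
by exists c.
Qed.

Let m_null A : A `&` K `<=` set0 -> m A = 0%E.
Proof.
move=> AK; apply/eqP; rewrite eq_le m_ge0 andbT.
apply: (@m_le _ (fun _ _ => 0)) => [|n]; last by rewrite L_zero.
split=> // [n|x _ n k _|x Kx Ax]; [exact: within_cst|by []|by case: (AK x)].
Qed.

Let m0 : m set0 = 0%E.
Proof. by apply: m_null; rewrite set0I. Qed.

Let m_subset : {homo m : A B / A `<=` B >-> (A <= B)%E}.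
Proof.
move=> A B AB; apply: le_ereal_inf_tmp => _ [c [h [ch h0 hn h1] hc] <-].
by apply: (@m_le _ h) => //; split => // x Kx /AB; exact: h1.
Qed.

(** With each [A k] approximated by a sequence [h k] up to e / 2^(k+1), the diagonal sums of [h k n]
    over k < n form a single nondecreasing sequence for the union: a point of [A k] is caught once n
    exceeds k and the index at which [h k] reaches 1 there. *)
Let m_sigma_subadditive : sigma_subadditive m.
Proof.
move=> A; apply/lee_addgt0Pr => e e0.
apply: le_trans (epsilon_trick xpredT (fun n => m_ge0 (A n)) (ltW e0)).
have e2 n : 0 < e / (2 ^ n.+1)%:R by rewrite divr_gt0// ltr0n expn_gt0.
have ex n := m_near (A n) (e2 n).
set s := (X in (_ <= X)%E).
have s0 : (0 <= s)%E.
  by apply: nneseries_ge0 => n _ _; rewrite adde_ge0 ?m_ge0// lee_fin ltW.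
have [->|sfin] := eqVneq s +oo%E; first by rewrite leey.
pose c n := projT1 (cid2 (ex n)).
have cm n : ((c n)%:E < m (A n) + (e / (2 ^ n.+1)%:R)%:E)%E.
  by rewrite /c; case: cid2.
have hex n : exists2 h, upper_approx (A n) h & forall k, L (h k) <= c n.
  by rewrite /c; case: cid2.
pose h n := projT1 (cid2 (hex n)).
have hA n : upper_approx (A n) (h n) by rewrite /h; case: cid2.
have hc n k : L (h n k) <= c n by rewrite /h; case: cid2.
have sE : s = (fine s)%:E by rewrite fineK// ge0_fin_numE// lt_neqAle sfin leey.
rewrite sE; apply: (@m_le _ (fun n x => \sum_(k < n) h k n x)); last first.
  move=> n; have [|_ ->] := @L_sum (fun k => h k n) n.
    by move=> k; case: (hA k).
  rewrite -lee_fin -sE -sumEFin.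
  apply: (@le_trans _ _ (\sum_(0 <= k < n) (m (A k) + (e / (2 ^ k.+1)%:R)%:E))%E).
    rewrite big_mkord; apply: lee_sum => k _.
    by apply: le_trans (ltW (cm k)); rewrite lee_fin.
  by apply: nneseries_lim_ge => k _ _; rewrite adde_ge0 ?m_ge0// lee_fin ltW.
split.
- move=> n; have [|//] := @L_sum (fun k => h k n) n.
  by move=> k; case: (hA k).
- by move=> n x Kx; apply: sumr_ge0 => k _; case: (hA k) => _ + _ _; apply.
- move=> x Kx; apply/nondecreasing_seqP => n; rewrite big_ord_recr/=.
  rewrite -[leLHS]addr0 lerD//; last by case: (hA n) => _ + _ _; apply.
  by apply: ler_sum => k _; case: (hA k) => _ _ + _; apply.
- move=> x Kx [k _ Akx]; case: (hA k) => _ h0 hn /(_ x Kx Akx)[n hn1].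
  exists (maxn n k.+1); have km : (k < maxn n k.+1)%N by rewrite leq_max leqnn orbT.
  rewrite (bigD1 (Ordinal km))//= -[leLHS]addr0 lerD//.
    by apply: (le_trans hn1); apply: hn => //; rewrite leq_max leqnn.
  by apply: sumr_ge0 => i _; case: (hA i) => _ + _ _; apply.
Qed.

HB.instance Definition _ := isOuterMeasure.Build R T m
  m0 m_ge0 m_subset m_sigma_subadditive.

(* For p k increasing to the indicator of U, split h n = h n * p k + h n * (1 - p k);
   the diagonal h n * p n approximates A `&` U, while h n * (1 - p k), k fixed,
   approximates A `\` U. *)
Let open_caratheodory (U : set T) : open U -> m.-caratheodory U.
Proof.
move=> /cozero[f [cf f0 fU]].
pose p n x := Num.min 1 (n%:R * f x).
have p0 n x : 0 <= p n x by rewrite le_min ler01 mulr_ge0.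
have p1 n x : p n x <= 1 by rewrite ge_min lexx.
have cp n : {within K, continuous (p n)}.
  apply: within_min; first exact: within_cst.
  by apply: within_mul; [exact: within_cst|exact: continuous_subspaceT].
have pn x : nondecreasing_seq (p ^~ x).
  apply/nondecreasing_seqP => n; rewrite /p le_min !ge_min lexx/=.
  by rewrite ler_wpM2r ?orbT// ler_nat.
have pU x : U x -> exists n, p n x = 1.
  rewrite fU/= => fx; exists (Num.bound (f x)^-1).
  apply/min_idPl; rewrite -ler_pdivrMr// mul1r ltW//.
  by rewrite archi_boundP ?invr_ge0.
have pUC n x : (~` U) x -> p n x = 0.
  rewrite fU/= => /negP; rewrite -leNgt /p => fx.
  have -> : f x = 0 by apply/eqP; rewrite eq_le fx f0.
  by rewrite mulr0; exact/min_idPr.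
apply: le_caratheodory_measurable => A.
apply: le_ereal_inf_tmp => _ [c [h [ch h0 hn h1] hc] <-].
have chp n k : {within K, continuous (fun x => h n x * p k x)} by exact: within_mul.
have chp' n k : {within K, continuous (fun x => h n x * (1 - p k x))}.
  apply: within_mul => //; apply: within_add; first exact: within_cst.
  rewrite (_ : (fun x => _) = (fun x => (-1) * p k x)).
    by apply: within_mul => //; exact: within_cst.
  by apply/funext => x; rewrite mulN1r.
have Lsplit n k : L (h n) =
    L (fun x => h n x * p k x) + L (fun x => h n x * (1 - p k x)).
  rewrite -L_add//; congr L; apply/funext => x.
  by rewrite -mulrDr addrC subrK mulr1.
have Lhp_le n k : L (fun x => h n x * p k x) <= c.
  apply: le_trans (hc n); apply: L_mono => // x Kx.
  by rewrite ler_piMr ?h0.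
(* [a] is the share of [c] spent on A [&] U; what remains is to bound A [\] U by [c - a]. *)
pose a := sup (range (fun n => L (fun x => h n x * p n x))).
have has_a : has_sup (range (fun n => L (fun x => h n x * p n x))).
  by split; [exists (L (fun x => h 0%N x * p 0%N x)), 0%N|exists c => _ [n _ <-]].
have aub n : L (fun x => h n x * p n x) <= a by apply: ub_le_sup; [case: has_a|exists n].
have mU : (m (A `&` U) <= a%:E)%E.
  apply: (@m_le _ (fun n x => h n x * p n x)) => //; split => //.
  - by move=> n x Kx; rewrite mulr_ge0 ?h0.
  - move=> x Kx; apply/nondecreasing_seqP => n; rewrite ler_pM ?h0//.
      by apply/nondecreasing_seqP: n; exact: hn.
    by apply/nondecreasing_seqP: n; exact: pn.
  - move=> x Kx [Ax /pU[k pk]]; have [n hn1] := h1 x Kx Ax.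
    exists (maxn n k); rewrite (_ : p _ _ = 1) ?mulr1.
      by apply: le_trans hn1 _; apply: hn => //; rewrite leq_max leqnn.
    by apply/eqP; rewrite eq_le p1 -{1}pk pn// leq_max leqnn orbT.
suff mUC : (m (A `&` ~` U) <= (c - a)%:E)%E.
  by rewrite (le_trans (leeD mU mUC))// -EFinD lee_fin addrC subrK.
apply/lee_addgt0Pr => e e0; rewrite -EFinD.
(* With [h k * p k] worth at least a - e, every later [h n * p k] is worth as much by monotonicity,
   so [h n * (1 - p k)] is left with at most c - a + e. Indices below k are first raised to
   [maxn n k]. *)
have [_ [k _ <-] ak] := sup_adherent e0 has_a; rewrite -/a in ak.
have hpk x : K x -> nondecreasing_seq (fun n => h n x * (1 - p k x)).
  by move=> Kx n n' nn'; rewrite ler_wpM2r ?subr_ge0 ?hn.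
apply: (@m_le _ (fun n x => h n x * (1 - p k x))); last first.
  move=> n; have : L (fun x => h n x * (1 - p k x)) <=
      L (fun x => h (maxn n k) x * (1 - p k x)).
    by apply: L_mono => // x Kx; apply: hpk => //; rewrite leq_max leqnn.
  move=> /le_trans; apply.
  have := hc (maxn n k); rewrite (Lsplit _ k) -lerBrDl => /le_trans; apply.
  have : L (fun x => h k x * p k x) <= L (fun x => h (maxn n k) x * p k x).
    apply: L_mono => // x Kx; rewrite ler_wpM2r//.
    by apply: hn => //; rewrite leq_max leqnn orbT.
  by move: ak; lra.
split => //.
- by move=> n x Kx; rewrite mulr_ge0 ?h0 ?subr_ge0.
- move=> x Kx [Ax Ux]; have [n hn1] := h1 x Kx Ax.
  by exists n; rewrite pUC// subr0 mulr1.
Qed.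

Let borel_caratheodory (A : set (borel T)) : measurable A -> m.-caratheodory A.
Proof.
move=> mA; apply: (smallest_sub _ _ mA); last exact: open_caratheodory.
have := @sigma_algebra_measurable _ (caratheodory_type [the outer_measure R T of m]).
exact.
Qed.

Let m_semi_sigma_additive : semi_sigma_additive (m : set (borel T) -> \bar R).
Proof.
move=> F mF tF mUF.
apply: (@caratheodory_measure_sigma_additive R T [the outer_measure R T of m]) => //.
- by move=> n; exact: borel_caratheodory.
- exact: borel_caratheodory.
Qed.

(** Dini's argument: a nondecreasing sequence of continuous functions that reaches 1 at each point
    of the compact K exceeds 1 - e on all of K from a single index on, whence c >= 1 - e for every
    admissible bound c. *)
Let m_setT : m setT = 1%E.
Proof.
apply/eqP; rewrite eq_le m_le1/=.
apply: le_ereal_inf_tmp => _ [c [h [ch h0 hn h1] hc] <-].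
rewrite lee_fin; apply/ler_addgt0Pl => e e0.
have : exists n, forall x, K x -> 1 - e <= h n x.
  have nearW1 : near_covering_within K.
    by apply/near_covering_withinP; apply/compact_near_coveringP.
  have [|N _ /(_ N (leqnn N)) hN] := nearW1 nat \oo (fun n y => 1 - e <= h n y) _.
    move=> x Kx; have [n hn1] := h1 x Kx I.
    have /subspace_continuousP/(_ x Kx)/cvgrPdist_lt/(_ _ e0) xe := ch n.
    exists ([set y | K y -> `|h n x - h n y| < e], [set k | (n <= k)%N]) => /=.
      by split; [exact: xe|exists n].
    move=> [y k]/= [ye nk] Ky; have {}ye := ye Ky.
    apply: (@le_trans _ _ (h n y)); last by apply: hn.
    rewrite lerBlDr (le_trans hn1)// -lerBlDl ltW//.
    by apply: le_lt_trans ye; rewrite ler_norm.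
  by exists N.
move=> [n hn1]; rewrite -lerBlDl (le_trans _ (hc n))//.
have -> : 1 - e = L (fun=> (1 - e) * 1).
  by rewrite L_scale ?L_one ?mulr1//; exact: within_cst.
apply: L_mono => //; first exact: within_mul (within_cst _) (within_cst _).
by move=> x Kx; rewrite mulr1; exact: hn1.
Qed.

HB.instance Definition _ := isMeasure.Build _ (borel T) R
  (m : set (borel T) -> \bar R) m0 m_ge0 m_semi_sigma_additive.

HB.instance Definition _ := Measure_isProbability.Build _ (borel T) R
  (m : set (borel T) -> \bar R) m_setT.

Let mu : probability (borel T) R := (m : set (borel T) -> \bar R).

Let measurableK : measurable (K : set (borel T)).
Proof. exact: closed_borel. Qed.

Let muK : mu K = 1%E.
Proof.
rewrite -(setCK K) probability_setC; last exact: measurableC.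
rewrite (_ : mu (~` K) = 0%E) ?sube0//; apply: m_null.
by move=> x [].
Qed.

(* Layer-cake argument in steps of height del: the truncations g k = min(f, k del)
   satisfy del * mu (f >= (k + 1) del) <= L (g (k + 1)) - L (g k). *)
Let integral_le (f : T -> R) : {within K, continuous f} ->
  (forall x, K x -> 0 <= f x <= 1) ->
  (\int[mu]_(x in K) (f x)%:E <= (L f)%:E)%E.
Proof.
move=> cf f01; apply/lee_addgt0Pr => e e0.
(* The step [del] is the inverse of an integer at least 1 / e: it is at most e, and since n del = 1
   the truncation [g n] is f itself. *)
pose n := (Num.bound e^-1).+1.
pose del : R := n%:R^-1.
have del0 : 0 < del by rewrite invr_gt0 ltr0n.
have dele : del <= e.
  rewrite -[e]invrK lef_pV2 ?posrE ?invr_gt0 ?ltr0n//.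
  apply: (le_trans (ltW (archi_boundP _))); first by rewrite invr_ge0 ltW.
  by rewrite ler_nat.
pose g k x := Num.min (f x) (k%:R * del).
have cg k : {within K, continuous (g k)} by apply: within_min => //; exact: within_cst.
have g0 k x : K x -> 0 <= g k x.
  by move=> /f01/andP[fx _]; rewrite le_min fx mulr_ge0// ltW.
have mg k : measurable_fun (K : set (borel T)) (fun x => (g k x)%:E).
  by apply/measurable_EFinP; exact: within_continuous_measurable.
pose A k : set T := K `&` [set x | k%:R * del <= f x].
have mA k : measurable (A k : set (borel T)).
  have := within_continuous_measurable closedK cf measurableK
    (measurable_itv `[k%:R * del, +oo[).
  congr (measurable _); apply/seteqP; split => x /=;
    by rewrite /A/= in_itv/= andbT.
have muA k : (del%:E * mu (A k.+1) <= (L (g k.+1) - L (g k))%:E)%E.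
  rewrite -lee_pdivlMl// -EFinM.
  (* The constant sequence (g (k+1) - g k) / del is admissible for [A k.+1]: it is nonnegative on K
     and equals 1 where f >= (k+1) del. *)
  apply: (@m_le _ (fun _ x => del^-1 * (g k.+1 x + (-1) * g k x))) => [|_].
    split=> [_|_ x Kx|x Kx n1 n2 _|x Kx [_ /= fx]]; last 1 first.
    - exists 0%N; rewrite mulrC ler_pdivlMr// mul1r mulN1r /g.
      rewrite (min_idPr _)// (min_idPr _); last first.
        by apply: le_trans fx; rewrite ler_wpM2r ?ler_nat// ltW.
      by rewrite -mulrBl -natrB// subSnn mul1r.
    - apply: within_mul; first exact: within_cst.
      by apply: within_add => //; apply: within_mul => //; exact: within_cst.
    - rewrite mulr_ge0 ?invr_ge0 ?(ltW del0)// mulN1r subr_ge0.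
      rewrite /g le_min !ge_min lexx/= ler_wpM2r ?orbT ?ler_nat//.
      exact: ltW.
    - by [].
  have cN : {within K, continuous (fun x => (-1) * g k x)}.
    by apply: within_mul => //; exact: within_cst.
  by rewrite L_scale ?L_add ?L_scale ?mulN1r//; exact: within_add.
(* The slab from level k+1 to k+2 is paid for by the increment of L one level lower, hence the shift
   of index; the bottom slab has no level below it and costs the extra [del]. *)
have step k : (\int[mu]_(x in K) (g k.+1 x)%:E <= (del + L (g k))%:E)%E.
  elim: k => [|k IHk].
    apply: (@le_trans _ _ (\int[mu]_(x in K) (cst del%:E) x)%E).
      apply: ge0_le_integral => //.
      - by move=> x Kx; rewrite lee_fin g0.
      - by move=> x Kx; rewrite lee_fin /g mul1r ge_min lexx orbT.
    rewrite integral_cst// [X in (_ * X)%E]muK mule1 lee_fin lerDl.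
    by apply: L_ge0 => // x; exact: g0.
  have mind : measurable_fun (K : set (borel T))
      (fun x => (del%:E * (\1_(A k.+1) x)%:E)%E).
    apply: measurable_funeM; apply/measurable_EFinP.
    by apply: measurable_funTS; exact: measurable_indic.
  apply: (@le_trans _ _ (\int[mu]_(x in K)
     ((g k.+1 x)%:E + del%:E * (\1_(A k.+1) x)%:E))%E).
    apply: ge0_le_integral => //.
    - by move=> x Kx; rewrite lee_fin g0.
    - exact: emeasurable_funD.
    - move=> x Kx; rewrite -EFinM -EFinD lee_fin /g indicE.
      case: (boolP (x \in A k.+1)) => xA.
        rewrite mulr1 -lerBlDr le_min !lerBlDr ge_min lerDl (ltW del0)/=.
        by rewrite -[k.+2]addn1 natrD mulrDl mul1r ge_min lexx orbT.
      rewrite mulr0 addr0 le_min ge_min lexx/= ge_min; apply/orP; left.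
      rewrite leNgt; apply/negP => fx; move/negP: xA; apply.
      by rewrite inE; split => //=; exact: ltW.
  rewrite ge0_integralD//; last 2 first.
  - by move=> x Kx; rewrite lee_fin g0.
  - by move=> x Kx; rewrite mule_ge0// lee_fin ltW.
  rewrite ge0_integralZl//; last 2 first.
  - by apply/measurable_EFinP; apply: measurable_funTS; exact: measurable_indic.
  - by rewrite lee_fin ltW.
  rewrite integral_indic// (_ : A k.+1 `&` K = A k.+1); last first.
    by rewrite /A setIAC setIid.
  apply: le_trans (leeD IHk (muA k)) _.
  by rewrite -EFinD lee_fin -addrA lerD2l addrC subrK.
have fg : forall x, K x -> f x = g n x.
  move=> x /f01/andP[_ fx]; apply/esym/min_idPl.
  by rewrite /del divff// pnatr_eq0.
apply: (@le_trans _ _ (\int[mu]_(x in K) (g n.+1 x)%:E)%E).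
  apply: ge0_le_integral => //.
  - by move=> x /f01/andP[]; rewrite lee_fin.
  - by apply/measurable_EFinP; exact: within_continuous_measurable.
  - move=> x Kx; rewrite lee_fin [leLHS]fg// /g le_min !ge_min lexx/=.
    by rewrite ler_wpM2r ?orbT ?ler_nat// ltW.
apply: le_trans (step n) _.
by rewrite -EFinD lee_fin addrC (L_eq cf (cg n) fg) lerD2l.
Qed.

(** [integral_le] for f and for 1 - f yields the two inequalities, because the integral and L both
    give 1 to the constant 1. *)
Theorem riesz_representation : exists mu : probability (borel T) R,
  mu K = 1%E /\ forall f : T -> R, {within K, continuous f} ->
    (forall x, K x -> 0 <= f x <= 1) ->
    (\int[mu]_(x in K) (f x)%:E = (L f)%:E)%E.
Proof.
exists mu; split=> // f cf f01.
have cN : {within K, continuous (fun x => (-1) * f x)}.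
  by apply: within_mul => //; exact: within_cst.
have c1 : {within K, continuous (fun x => 1 + (-1) * f x)}.
  by apply: within_add => //; exact: within_cst.
have f1 x : K x -> 0 <= 1 + (-1) * f x <= 1.
  move=> /f01/andP[fx0 fx1]; rewrite mulN1r subr_ge0 fx1/=.
  by rewrite lerBlDr lerDl.
apply/eqP; rewrite eq_le integral_le//=.
have := integral_le c1 f1.
rewrite L_add//; last exact: within_cst.
rewrite L_scale// L_one mulN1r.
have f_fin : (\int[mu]_(x in K) (f x)%:E)%E \is a fin_num.
  rewrite ge0_fin_numE; last first.
    by apply: integral_ge0 => x /f01/andP[]; rewrite lee_fin.
  by rewrite (le_lt_trans (integral_le cf f01))// ltry.
have int1 : (\int[mu]_(x in K) (1 + -1 * f x)%:E + \int[mu]_(x in K) (f x)%:E = 1)%E.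
  rewrite -ge0_integralD//.
  - rewrite (eq_integral (cst 1%E)) ?integral_cst ?mul1e//.
    by move=> x _; rewrite -EFinD mulN1r subrK.
  - by move=> x /f1/andP[]; rewrite lee_fin.
  - by apply/measurable_EFinP; exact: within_continuous_measurable.
  - by move=> x /f01/andP[]; rewrite lee_fin.
  - by apply/measurable_EFinP; exact: within_continuous_measurable.
move=> /(leeD2r (\int[mu]_(x in K) (f x)%:E)%E).
by rewrite int1 -(fineK f_fin) -EFinD !lee_fin addrAC lerBrDr lerD2l.
Qed.

End riesz.

(** * Continuity of flows in the initial condition *)

Section flow_continuity.
Context {R : realType} {d : nat}.
Implicit Types (M : set 'rV[R]_d) (x y v : 'rV[R]_d).

Lemma ler_coord_norm v k : `|v 0 k| <= `|v|.
Proof.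
rewrite [leRHS]/Num.Def.normr/= mx_normrE.
exact: (le_bigmax _ (fun i : 'I_1 * 'I_d => `|v i.1 i.2|) (0, k)).
Qed.

(** The norm of row vectors is the maximum norm, which is not differentiable; Gronwall's argument
    works with the sum of squares, and the comparison costs a factor d. *)
Lemma ler_norm_sum_sqr v : `|v| ^+ 2 <= \sum_k v 0 k ^+ 2.
Proof.
have sge0 : 0 <= \sum_k v 0 k ^+ 2 by apply: sumr_ge0 => k _; exact: sqr_ge0.
rewrite -[leRHS]sqr_sqrtr// ler_sqr ?nnegrE ?sqrtr_ge0//.
rewrite [leLHS]/Num.Def.normr/= mx_normrE bigmax_le ?sqrtr_ge0// => -[i k] _ /=.
rewrite (ord1 i) -ler_sqr ?nnegrE ?sqrtr_ge0// sqr_sqrtr// real_normK ?num_real//.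
by rewrite (bigD1 k)//= lerDl sumr_ge0// => j _; exact: sqr_ge0.
Qed.

Lemma ler_sum_sqr_norm v : \sum_k v 0 k ^+ 2 <= d%:R * `|v| ^+ 2.
Proof.
rewrite -[d in d%:R]card_ord mulr_natl -sumr_const; apply: ler_sum => k _.
by rewrite -[leLHS]real_normK ?num_real// ler_sqr ?nnegrE// ler_coord_norm.
Qed.

Lemma is_derive_coord (f : R -> 'rV[R]_d) (t : R) v (k : 'I_d) :
  is_derive t 1 f v -> is_derive t 1 (fun s => f s 0 k) (v 0 k).
Proof.
move=> [df <-]; apply: DeriveDef; first by move/derivable_mxP: df; apply.
by rewrite derive_mx// mxE.
Qed.

Lemma is_derive_segment (F : 'rV[R]_d -> 'rV[R]_d) y v (s : R) :
  differentiable F (y + s *: v) ->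
  is_derive s 1 (fun s => F (y + s *: v)) ('D_v F (y + s *: v)).
Proof.
move=> dF; have dseg : is_diff s (cst y + *:%R^~ v) (0 + *:%R^~ v).
  exact: is_diffD.
have -> : (fun s => F (y + s *: v)) = F \o (cst y + *:%R^~ v) by [].
have d1 : differentiable (cst y + *:%R^~ v) s by case: dseg.
have d2 : differentiable F ((cst y + *:%R^~ v) s) by [].
have d3 := differentiable_comp d1 d2.
apply: DeriveDef; first exact: diff_derivable.
by rewrite deriveE// diff_comp// /= diff_val/= add0r scale1r -deriveE.
Qed.

(** M is not assumed convex, so the derivatives are bounded on [H], the union of all segments
    joining points of M, compact as an image of [0, 1] * M * M. [class_C] gives continuity of each
    directional derivative separately, hence the expansion of x - y along the basis; the mean value
    theorem is applied coordinate by coordinate. *)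
Lemma lipschitz_on_compact (F : 'rV[R]_d -> 'rV[R]_d) M :
  compact M -> class_C 1 F -> exists2 C : R, 0 <= C &
  forall x y, M x -> M y -> `|F x - F y| <= C * `|x - y|.
Proof.
move=> cM [dF cF].
pose seg (p : R * ('rV[R]_d * 'rV[R]_d)) := p.2.2 + p.1 *: (p.2.1 - p.2.2).
pose H := seg @` (`[0, 1] `*` (M `*` M)).
have cseg : continuous seg.
  move=> p; apply: cvgD.
    by apply: continuous_comp; [exact: cvg_snd|exact: cvg_snd].
  apply: cvgZ; first exact: cvg_fst.
  apply: cvgB; first by apply: continuous_comp; [exact: cvg_snd|exact: cvg_fst].
  by apply: continuous_comp; [exact: cvg_snd|exact: cvg_snd].
have cH : compact H.
  apply: continuous_compact; first exact: continuous_subspaceT.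
  by apply: compact_setX; [exact: segment_compact|exact: compact_setX].
have bD (m : 'I_d) : exists2 N : R, 0 <= N &
    forall p, H p -> `|'D_(delta_mx 0 m) F p| <= N.
  have : compact ('D_(delta_mx 0 m) F @` H).
    apply: continuous_compact => //; apply: continuous_subspaceT; exact: cF.
  move=> /compact_bounded[N [_ NP]]; exists (`|N| + 1); first by rewrite addr_ge0.
  move=> p Hp; apply: NP; last by exists p.
  by rewrite (le_lt_trans (ler_norm _))// ltrDl.
pose N m := projT1 (cid2 (bD m)).
have N0 m : 0 <= N m by rewrite /N; case: cid2.
have NP m p : H p -> `|'D_(delta_mx 0 m) F p| <= N m.
  by rewrite /N; case: cid2 => /= ? _; exact.
exists (\sum_m N m); first exact: sumr_ge0.
move=> x y Mx My.
have C0 : 0 <= (\sum_m N m) * `|x - y| by rewrite mulr_ge0// sumr_ge0.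
rewrite [leLHS]/Num.Def.normr/= mx_normrE bigmax_le// => -[i k] _ /=.
rewrite (ord1 i) !mxE.
have dphi (s : R) : is_derive s 1 (fun s => F (y + s *: (x - y)) 0 k)
    ('D_(x - y) F (y + s *: (x - y)) 0 k).
  by apply: is_derive_coord; apply: is_derive_segment.
have cphi : {within `[0, 1], continuous (fun s : R => F (y + s *: (x - y)) 0 k)}.
  by apply: derivable_within_continuous => s _; have [] := dphi s.
have [s s01] := MVT_segment ler01 (fun s _ => dphi s) cphi.
rewrite scale1r scale0r addr0 subr0 mulr1 [y + _]addrC subrK => ->.
have Hs : H (y + s *: (x - y)) by exists (s, (x, y)).
move: Hs (dF (y + s *: (x - y))); move: (y + _) => p Hp dFp.
have -> : 'D_(x - y) F p = \sum_m (x - y) 0 m *: 'D_(delta_mx 0 m) F p.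
  move: (x - y) => v; rewrite deriveE// {1}(row_sum_delta v) linear_sum.
  by apply: eq_bigr => m _; rewrite linearZ/= deriveE.
rewrite summxE mulr_suml (le_trans (ler_norm_sum _ _ _))// ler_sum// => m _.
rewrite mxE normrM mulrC ler_pM//; last exact: ler_coord_norm.
exact: le_trans (ler_coord_norm _ _) (NP _ _ Hp).
Qed.

(* Gronwall's argument: by Lipschitz continuity, the squared Euclidean distance
   between two trajectories times exp(- 2 d C t) is nonincreasing. *)
Lemma flow_lipschitz (F : 'rV[R]_d -> 'rV[R]_d)
    (Phi : R -> 'rV[R]_d -> 'rV[R]_d) M (C : R) :
  is_flow F Phi -> (forall t, 0 <= t -> Phi t @` M `<=` M) ->
  0 <= C -> (forall x y, M x -> M y -> `|F x - F y| <= C * `|x - y|) ->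
  forall x y t, M x -> M y -> 0 <= t ->
  `|Phi t x - Phi t y| ^+ 2 <= expR (2 * d%:R * C * t) * (d%:R * `|x - y| ^+ 2).
Proof.
move=> flow MPhi C0 FC x y t Mx My t0.
pose D s k := Phi s x 0 k - Phi s y 0 k.
pose D' s k := F (Phi s x) 0 k - F (Phi s y) 0 k.
have dD (s : R) k : is_derive s 1 (D ^~ k) (D' s k).
  apply: is_deriveB; apply: is_derive_coord; last by have [_] := flow y; apply.
  by have [_] := flow x; apply.
pose h s := \sum_k D s k ^+ 2.
have dh (s : R) : is_derive s 1 h (\sum_k 2 * (D s k * D' s k)).
  have -> : h = \sum_k (D ^~ k) ^+ 2 by apply/funext => u; rewrite fct_sumE.
  apply: is_derive_eq; apply: eq_bigr => k _.
  by rewrite expr1 /GRing.scale/= mulrA.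
(* Each of the d terms 2 D D' of the derivative of h is at most 2 C times the squared maximum norm
   of the difference, itself at most h. *)
pose B := 2 * d%:R * C.
pose g s := h s * expR (- B * s).
have dg (s : R) : is_derive s 1 g
    (expR (- B * s) * (\sum_k 2 * (D s k * D' s k) - B * h s)).
  have dE : is_derive s 1 (fun u => expR (- B * u)) (expR (- B * s) * - B).
    apply: (@is_derive1_comp _ expR (fun u => - B * u)).
    have -> : (fun u => - B * u) = (- B) \*: (@id R) by [].
    by apply: is_derive_eq; rewrite /GRing.scale/= mulr1.
  have -> : g = h * (fun u => expR (- B * u)) by [].
  apply: is_derive_eq; rewrite /GRing.scale/=; ring.
have g_le : g t <= g 0.
  apply: (@ler0_derive1_nincry R g 0) => //.
  - move=> s; rewrite in_itv/= andbT => s0.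
    rewrite derive1E (@derive_val _ _ _ _ _ _ _ (dg s)).
    rewrite mulr_ge0_le0 ?expR_ge0// subr_le0.
    have MPs z : M z -> M (Phi s z) by move=> Mz; apply: (MPhi s (ltW s0)); exists z.
    have hs : `|Phi s x - Phi s y| ^+ 2 <= h s.
      apply: le_trans (ler_norm_sum_sqr _) _; apply: ler_sum => k _.
      by rewrite !mxE.
    rewrite /B -mulrA -mulr_sumr -mulrA ler_pM2l//.
    apply: (@le_trans _ _ (\sum_(k < d) C * `|Phi s x - Phi s y| ^+ 2)).
      apply: ler_sum => k _; rewrite (le_trans (ler_norm _))// normrM.
      rewrite expr2 mulrCA mulrC [leRHS]mulrC ler_pM//.
        apply: le_trans (FC _ _ (MPs _ Mx) (MPs _ My)).
        by apply: le_trans (ler_coord_norm _ k); rewrite !mxE.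
      by apply: le_trans (ler_coord_norm _ k); rewrite !mxE.
    rewrite sumr_const card_ord -[leLHS]mulr_natl -?mulrA; do 2!apply: ler_wpM2l => //.
  - apply: continuous_subspaceT => s; apply: differentiable_continuous.
    by apply/derivable1_diffP; have [] := dg s.
have h0 : h 0 <= d%:R * `|x - y| ^+ 2.
  apply: le_trans _ (ler_sum_sqr_norm _); apply: ler_sum => k _.
  by rewrite /D !mxE; have [-> _] := flow x; have [-> _] := flow y.
rewrite mulrC -ler_pdivrMr ?expR_gt0// -expRN -mulNr.
apply: le_trans h0; have -> : h 0 = g 0 by rewrite /g mulr0 expR0 mulr1.
apply: le_trans g_le; rewrite ler_wpM2r ?expR_ge0//.
apply: le_trans (ler_norm_sum_sqr _) _; apply: ler_sum => k _.
by rewrite !mxE.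
Qed.

Lemma flow_continuous (F : 'rV[R]_d -> 'rV[R]_d)
    (Phi : R -> 'rV[R]_d -> 'rV[R]_d) M :
  smooth F -> is_flow F Phi -> compact M ->
  (forall t, 0 <= t -> Phi t @` M `<=` M) ->
  forall t, 0 <= t -> {within M, continuous (Phi t)}.
Proof.
move=> sF flow cM MPhi t t0.
have [C C0 FC] := lipschitz_on_compact cM (sF 1%N).
pose A := expR (2 * d%:R * C * t) * d%:R.
have A0 : 0 <= A by rewrite mulr_ge0 ?expR_ge0.
apply/subspace_continuousP => x Mx; apply/cvgrPdist_lt => e e0.
(* The bound A <= (A + 1)^2 avoids a square root, and the added 1 a division by zero. *)
pose del := e / (A + 1).
have del0 : 0 < del by rewrite divr_gt0// ltr_wpDl.
rewrite near_withinE; near=> y => My.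
have xy : `|x - y| < del.
  near: y; apply/nbhs_ballP.
  by exists del => //= z; rewrite -ball_normE.
rewrite -ltr_sqr ?nnegrE ?(ltW e0)//.
apply: (le_lt_trans (flow_lipschitz flow MPhi C0 FC Mx My t0)).
rewrite mulrA -/A.
have : `|x - y| * (A + 1) < e by rewrite -ltr_pdivlMr// ltr_wpDl.
rewrite -ltr_sqr ?nnegrE ?(ltW e0) ?mulr_ge0 ?addr_ge0//; apply: le_lt_trans.
rewrite exprMn mulrC ler_wpM2l ?sqr_ge0//.
by move: A0; nra.
Unshelve. all: by end_near.
Qed.

Lemma flow_time_continuous (F : 'rV[R]_d -> 'rV[R]_d)
    (Phi : R -> 'rV[R]_d -> 'rV[R]_d) x :
  is_flow F Phi -> continuous (Phi ^~ x).
Proof.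
move=> flow t; apply: differentiable_continuous; apply/derivable1_diffP.
by have [_ /(_ t)[]] := flow x.
Qed.

End flow_continuity.

(** * Bounded functions and Borel sets *)

Section bounded_integration.
Context {disp : measure_display} {X : measurableType disp} {R : realType}.
Variables (mu : probability X R) (D : set X).
Hypothesis measurableD : measurable D.
Implicit Types (f : X -> R) (B : R).

Lemma bounded_integrable f B : measurable_fun D f ->
  (forall x, D x -> `|f x| <= B) -> mu.-integrable D (EFin \o f).
Proof.
move=> mf fB; apply: measurable_bounded_integrable => //.
  by rewrite (le_lt_trans (probability_le1 mu measurableD))// ltry.
by exists B; split; [exact: num_real|move=> M BM x /fB/le_trans; apply; exact: ltW].
Qed.

Lemma bounded_cvg_Rintegral (h : nat -> X -> R) f B :
  (forall n, measurable_fun D (h n)) ->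
  (forall n x, D x -> `|h n x| <= B) ->
  (forall x, D x -> h ^~ x @ \oo --> f x) ->
  (\int[mu]_(x in D) h n x) @[n --> \oo] --> \int[mu]_(x in D) f x.
Proof.
move=> mh hB hf.
have mf : measurable_fun D f by exact: (measurable_fun_cvg mh hf).
have fB x : D x -> `|f x| <= B.
  move=> Dx; apply: (cvgr_to_le (cvg_norm (hf x Dx))).
  by apply: nearW => n; exact: hB.
apply: fine_cvg; rewrite fineK; last first.
  by apply: integrable_fin_num => //; exact: bounded_integrable fB.
apply: (@dominated_cvg _ _ _ mu D measurableD (fun n => EFin \o h n) _ (cst B%:E)) => //.
- by move=> n; apply/measurable_EFinP.
- by move=> x Dx; apply: cvg_EFin; [exact: nearW|exact: hf].
- by apply: (@bounded_integrable (cst B) `|B|) => // x _.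
Qed.

End bounded_integration.

(** The function is the distance to the complement of U; truncation at 1 keeps it finite, in
    particular when that complement is empty. *)
Lemma open_is_cozero {R : realType} {T : pseudoMetricType R} (U : set T) : open U ->
  exists f : T -> R, [/\ continuous f, forall x, 0 <= f x & U = [set x | 0 < f x]].
Proof.
move=> oU; pose g (x : T) := mine 1%E (edist_inf (~` U) x).
have g0 x : (0 <= g x)%E by rewrite le_min lee01 edist_inf_ge0.
have gfin x : g x \is a fin_num.
  by rewrite ge0_fin_numE// (@le_lt_trans _ _ 1%E) ?ltry// ge_min lexx.
exists (fine \o g); split.
- move=> x; apply: fine_cvg; rewrite fineK//.
  apply: (@continuous2_cvg _ _ _ _ _ _ (cst 1%E) (edist_inf (~` U))
    (fun a b => mine a b)).
  - exact: (@min_continuous _ (\bar R) (1%E, edist_inf (~` U) x)).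
  - exact: cvg_cst.
  - exact: edist_inf_continuous.
- by move=> x; exact: fine_ge0.
- apply/seteqP; split => x /=.
    move=> Ux; have /nbhs_ballP[e /= e0 eU] := open_nbhs_nbhs (conj oU Ux).
    rewrite fine_gt0// -ge0_fin_numE// gfin andbT lt_min lte01/=.
    apply: (@lt_le_trans _ _ e%:E); first by rewrite lte_fin.
    apply: le_ereal_inf_tmp => _ [y Uy <-].
    apply: le_ereal_inf_tmp => _ [r [/= r0 xr] <-]; rewrite lee_fin leNgt.
    apply/negP => re; apply: Uy; apply: eU; exact: le_ball (ltW re) _ xr.
  apply: contraPP => Ux; rewrite /g /= edist_inf0//.
  by rewrite (min_idPr _)//= ltxx.
Qed.

Section indicator_induction.
Context {R : realType} {T : ptopologicalType}.
Hypothesis cozero : forall U : set T, open U ->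
  exists f : T -> R, [/\ continuous f, forall x, 0 <= f x & U = [set x | 0 < f x]].
Variable H : (T -> R) -> Prop.
Hypothesis H_continuous : forall f : T -> R,
  continuous f -> (forall x, 0 <= f x <= 1) -> H f.
Hypothesis H_add : forall f g, H f -> H g -> H (fun x => f x + g x).
Hypothesis H_opp : forall f, H f -> H (fun x => - f x).
Hypothesis H_cvg : forall (h : nat -> T -> R) f, (forall n, H (h n)) ->
  (forall n x, 0 <= h n x <= 1) -> (forall x, h ^~ x @ \oo --> f x) -> H f.

(** Functional form of Dynkin's theorem: open sets are stable under intersection and their
    indicators are limits of min(1, n f), while closure of [H] under sums, opposites and limits
    handles complements and disjoint unions. The limits are those of sequences valued in [0, 1], so
    that bounded convergence can prove [H_cvg]. *)
Lemma indicator_induction (A : set (borel T)) : measurable A -> H \1_A.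
Proof.
have H1 : H (cst 1).
  by apply: H_continuous => x; [exact: cvg_cst|rewrite ler01 lexx].
have H0 : H (cst 0).
  by apply: H_continuous => x; [exact: cvg_cst|rewrite ler01 lexx].
move=> mA; apply: (@dynkin_induction _ (borel T) open (fun S => H \1_S)) mA => //.
- exact: openI.
- by rewrite indicT.
- move=> U /cozero[f [cf f0 ->]].
  apply: (@H_cvg (fun n x => Num.min 1 (n%:R * f x))).
  + move=> n; apply: H_continuous => x; last first.
      by rewrite le_min ler01 mulr_ge0//= ge_min lexx.
    apply: (@continuous_min _ _ (fun=> 1) (fun x => n%:R * f x)); first exact: cvg_cst.
    by apply: cvgM; [exact: cvg_cst|exact: cf].
  + by move=> n x; rewrite le_min ler01 mulr_ge0//= ge_min lexx.
  + move=> x; rewrite indicE; have [fx|fx] := pselect (0 < f x).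
      rewrite mem_set//; apply: cvg_near_cst; near=> n; apply/min_idPl.
      rewrite -ler_pdivrMr// mul1r ltW//.
      by near: n; exact: nbhs_infty_gtr.
    have -> : f x = 0 by apply/eqP; rewrite eq_le f0 andbT leNgt; exact/negP.
    rewrite memNset//; apply: cvg_near_cst; near=> n.
    by rewrite mulr0; exact/min_idPr.
- move=> S mS HS.
  have -> : \1_(~` S) = (fun x => cst 1 x + - \1_S x) :> (T -> R).
    apply/funext => x; rewrite !indicE in_setC.
    by case: (x \in S); rewrite /= ?subrr ?subr0.
  by apply: H_add => //; exact: H_opp.
- move=> F mF tF HF.
  apply: (@H_cvg (fun n => \1_(\big[setU/set0]_(k < n) F k))).
  + elim=> [|n IHn]; first by rewrite big_ord0 indic0.
    rewrite big_ord_recr/=.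
    rewrite (_ : \1_(_ `|` _) = (fun x =>
        \1_(\big[setU/set0]_(k < n) F k) x + \1_(F n) x)).
      exact: H_add.
    apply/funext => x; rewrite !indicE in_setU -natrD; congr (_%:R).
    case: (boolP (x \in F n)) => [/set_mem Fnx|_]; last by rewrite orbF addn0.
    rewrite orbT memNset// -bigcup_mkord => -[k /= kn Fkx].
    have kn' : k = n by apply: tF => //; exists x.
    by rewrite kn' ltnn in kn.
  + by move=> n x; rewrite indicE ler0n/= lern1 leq_b1.
  + move=> x; rewrite [\1_(\bigcup_k F k) x]indicE.
    have [[k _ Fkx]|Fx] := pselect ((\bigcup_k F k) x).
      rewrite mem_set; last by exists k.
      apply: cvg_near_cst; exists k.+1 => // n /= kn.
      rewrite indicE mem_set// -bigcup_mkord; exists k => //.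
    rewrite memNset//; apply: cvg_near_cst; apply: nearW => n.
    rewrite indicE memNset// -bigcup_mkord => -[k _ Fkx].
    by apply: Fx; exists k.
Unshelve. all: by end_near.
Qed.

End indicator_induction.

Lemma cvg_finite_sum {R : realType} {I J : Type} (F : set_system I) {FF : Filter F}
    (r : seq J) (p : pred J) (f : J -> I -> R) (l : J -> R) :
  (forall j, p j -> f j @ F --> l j) ->
  (fun i => \sum_(j <- r | p j) f j i) @ F --> \sum_(j <- r | p j) l j.
Proof.
move=> fl; elim: r => [|j r IHr].
  rewrite big_nil; under eq_fun do rewrite big_nil; exact: cvg_cst.
rewrite big_cons; under eq_fun do rewrite big_cons.
by case: (boolP (p j)) => pj //; apply: cvgD => //; exact: fl.
Qed.

(** Dominated convergence speaks of sequences; this turns it into the continuity needed for the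
    Feller property. *)
Lemma within_continuous_seq {R : realType} {V W : normedModType R} (D : set V)
    (f : V -> W) :
  (forall (x : V) (u : nat -> V), D x -> (forall n, D (u n)) ->
    u @ \oo --> x -> f (u n) @[n --> \oo] --> f x) ->
  {within D, continuous f}.
Proof.
move=> fseq; apply/subspace_continuousP => x Dx; apply/cvgrPdist_lt => e e0.
apply: contrapT => fx.
have bad n : exists y, [/\ D y, `|x - y| < n.+1%:R^-1 & e <= `|f x - f y|].
  apply: contrapT => nobad; apply: fx.
  apply/nbhs_ballP; exists n.+1%:R^-1; first by rewrite /= invr_gt0 ltr0n.
  move=> y; rewrite -ball_normE /= => xy Dy; rewrite ltNge; apply/negP => fy.
  by apply: nobad; exists y.
have [u /all_and3[Du xu fu]] := choice bad.
have ux : u @ \oo --> x.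
  apply/cvgrPdist_lt => r r0; near=> n.
  apply: (lt_trans (xu n)); near: n; exact: near_infty_natSinv_lt (PosNum r0).
have /cvgrPdist_lt/(_ _ e0)[N _ /(_ N (leqnn N))] := fseq x u Dx Du ux.
by rewrite /= ltNge fu.
Unshelve. all: by end_near. Qed.

Lemma continuous_borel {R : realType} {T : ptopologicalType} (D : set R) (g : R -> T) :
  continuous g -> measurable_fun D (g : R -> borel T).
Proof.
move=> cg; apply: measurable_funTS.
apply: (@measurability _ _ _ (borel T) setT g open erefl) => _ [U oU <-].
by rewrite setTI; apply: open_measurable; by move/continuousP: cg; apply.
Qed.

Lemma full_measureI {disp : measure_display} {X : measurableType disp} {R : realType}
    (mu : probability X R) (S A : set X) : measurable S -> mu S = 1%E ->
  measurable A -> mu (A `&` S) = mu A.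
Proof.
move=> mS muS mA.
have muSC : mu (~` S) = 0%E by rewrite probability_setC// muS subee.
have AC : mu (A `&` ~` S) = 0%E.
  apply/eqP; rewrite eq_le measure_ge0 andbT -muSC le_measure ?inE//.
    by apply: measurableI => //; exact: measurableC.
  exact: measurableC.
rewrite [RHS](measureDI mu mA mS) setDE [X in (X + _)%E](_ : _ = 0%E) ?add0e//.
Qed.

Lemma ultra_fmap (X Y : Type) (f : X -> Y) (F : set_system X) :
  UltraFilter F -> UltraFilter (f @ F).
Proof.
move=> UF; split=> [|G PG FG]; first exact: fmap_proper_filter.
apply/seteqP; split=> A; last exact: FG.
move=> GA; have [//|FA] := in_ultra_setVsetC (f @^-1` A) UF.
have GCA : G (~` A) by exact: FG.
by have /filter_ex[y []] : G (A `&` ~` A) by exact: filterI.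
Qed.

(** * The transition operator *)

Section chain.
Context {R : realType} {d : nat} {E : pointedFinType}.
Variables (Phi : E -> R -> 'rV[R]_d -> 'rV[R]_d) (M : set 'rV[R]_d).
Hypothesis M_compact : compact M.
Hypothesis Phi_continuous : forall i t, 0 <= t -> {within M, continuous (Phi i t)}.
Hypothesis Phi_time_continuous : forall i x, continuous (Phi i ^~ x).
Hypothesis M_invariant : forall i t x, 0 <= t -> M x -> M (Phi i t x).
Variables (rate : 'rV[R]_d -> E -> E -> R) (lambda : R).
Hypothesis rate_continuous :
  forall i j, {within M, continuous (fun x => rate x i j)}.
Hypothesis rate_ge0 : forall x i j, M x -> i != j -> 0 <= rate x i j.
Hypothesis lambda_gt : forall x i, M x -> \sum_(j | j != i) rate x i j < lambda.

Local Notation T := (state R d E).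
Local Notation q := (jump_prob rate lambda).

Definition product_space : set T := M `*` setT.
Local Notation S := product_space.

Lemma jump_prob_sum x i : \sum_j q x i j = 1.
Proof.
rewrite (bigD1 i)//= [X in _ + X](_ : _ = \sum_(j | j != i) rate x i j / lambda).
  by rewrite /jump_prob eqxx subrK.
by apply: eq_bigr => j /negPf ji; rewrite /jump_prob ji.
Qed.

Lemma jump_prob_diag_gt0 x i : M x -> 0 < q x i i.
Proof.
move=> Mx; rewrite /jump_prob eqxx subr_gt0 -mulr_suml.
have l0 : 0 < lambda.
  apply: le_lt_trans (lambda_gt i Mx); apply: sumr_ge0 => j ji.
  by rewrite rate_ge0// eq_sym.
by rewrite ltr_pdivrMr// mul1r lambda_gt.
Qed.

Lemma jump_prob_gt0 x i j : M x -> j != i -> 0 < rate x i j -> 0 < q x i j.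
Proof.
move=> Mx ji rij; rewrite /jump_prob (negPf ji) divr_gt0//.
apply: le_lt_trans (lambda_gt i Mx); apply: sumr_ge0 => k ki.
by rewrite rate_ge0// eq_sym.
Qed.

Lemma jump_prob_ge0 x i j : M x -> 0 <= q x i j.
Proof.
move=> Mx; have [->|ji] := eqVneq j i; first exact/ltW/jump_prob_diag_gt0.
rewrite /jump_prob (negPf ji) divr_ge0//; first by rewrite rate_ge0// eq_sym.
apply/ltW; apply: le_lt_trans (lambda_gt i Mx); apply: sumr_ge0 => k ki.
by rewrite rate_ge0// eq_sym.
Qed.

Lemma jump_prob_continuous i j : {within M, continuous (fun x => q x i j)}.
Proof.
rewrite /jump_prob; case: (j == i) => x; last first.
  by apply: cvgM; [exact: rate_continuous|exact: cvg_cst].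
apply: cvgB; first exact: cvg_cst.
apply: cvg_finite_sum => k _.
by apply: cvgM; [exact: rate_continuous|exact: cvg_cst].
Qed.

Lemma product_space_compact : compact (S : set T).
Proof.
apply: compact_setX => //; apply: finite_compact.
exact: (@finite_finset E setT).
Qed.

Lemma product_space_closed : closed (S : set T).
Proof.
have cM : closed M by apply: compact_closed => //; exact: norm_hausdorff.
have -> : S = fst @^-1` M by apply/seteqP; split => [z []|z].
by apply: closed_comp => // z _; exact: cvg_fst.
Qed.

Lemma product_space_measurable : measurable (S : set (borel T)).
Proof. by apply: closed_borel; exact: product_space_closed. Qed.

(** Each regime is isolated in the discrete E, so a neighbourhood of (x, i) can be taken inside the
    slice of i. *)
Lemma within_product_space (f : T -> R) :
  {within S, continuous f} <->
  forall j, {within M, continuous (fun x => f (x, j))}.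
Proof.
split=> [/subspace_continuousP cf j|cf]; apply/subspace_continuousP.
- move=> x Mx A /(cf (x, j) (conj Mx I)) -[[U V] /= [xU jV] UV].
  apply: filterS xU => y Uy My; apply: UV => //; split=> //=.
  exact: nbhs_singleton jV.
- move=> [x i] [/= Mx _] A Afx.
  have /subspace_continuousP/(_ x Mx A Afx) := cf i.
  rewrite nbhs_simpl/= => xA.
  exists ([set y | M y -> A (f (y, i))], [set i]) => /=.
    by split; [exact: xA|exact: (@discrete_set1 (discrete_topology E))].
  by move=> [y k] [/= yA ->] [/= My _]; exact: yA.
Qed.

Lemma open_state_cozero (U : set T) : open U ->
  exists f : T -> R, [/\ continuous f, forall x, 0 <= f x & U = [set x | 0 < f x]].
Proof.
exact: (@open_is_cozero R ('rV[R]_d * discrete_topology E)%type).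
Qed.

Definition bounded_measurable (f : T -> R) :=
  measurable_fun (S : set (borel T)) f /\
  exists B, forall z, S z -> `|f z| <= B.

Definition next_regime_mean (f : T -> R) (i : E) (y : 'rV[R]_d) : R :=
  \sum_j q y i j * f (y, j).

Lemma next_regime_mean_bound (f : T -> R) B i y :
  (forall z, S z -> `|f z| <= B) -> M y -> `|next_regime_mean f i y| <= B.
Proof.
move=> fB My; rewrite (le_trans (ler_norm_sum _ _ _))//.
rewrite -[leRHS]mul1r -(jump_prob_sum y i) mulr_suml; apply: ler_sum => j _.
by rewrite normrM ger0_norm ?jump_prob_ge0// ler_wpM2l ?jump_prob_ge0 ?fB.
Qed.

Lemma next_regime_mean_continuous (f : T -> R) i : {within S, continuous f} ->
  {within M, continuous (next_regime_mean f i)}.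
Proof.
move=> cf y; apply: cvg_finite_sum => j _; apply: cvgM; first exact: jump_prob_continuous.
by have /within_product_space := cf; exact.
Qed.

Lemma bounded_measurable_continuous (f : T -> R) :
  {within S, continuous f} -> bounded_measurable f.
Proof.
move=> cf; split; first exact: within_continuous_measurable product_space_closed cf.
have /compact_bounded[B [_ fB]] := continuous_compact cf product_space_compact.
exists (`|B| + 1) => z Sz; apply: fB; last by exists z.
by rewrite (le_lt_trans (ler_norm _))// ltrDl.
Qed.

Lemma bounded_measurableD (f g : T -> R) : bounded_measurable f ->
  bounded_measurable g -> bounded_measurable (fun z => f z + g z).
Proof.
move=> [mf [B fB]] [mg [C gC]]; split; first exact: measurable_funD.
by exists (B + C) => z Sz; rewrite (le_trans (ler_normD _ _))// lerD ?fB ?gC.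
Qed.

Lemma bounded_measurableN (f : T -> R) : bounded_measurable f ->
  bounded_measurable (fun z => - f z).
Proof.
move=> [mf [B fB]]; split; first exact: measurableT_comp.
by exists B => z Sz; rewrite normrN fB.
Qed.

Lemma bounded_measurable_cvg (h : nat -> T -> R) (f : T -> R) B :
  (forall n, bounded_measurable (h n)) -> (forall n z, S z -> `|h n z| <= B) ->
  (forall z, S z -> h ^~ z @ \oo --> f z) -> bounded_measurable f.
Proof.
move=> bh hB hf; split.
  by apply: (@measurable_fun_cvg _ (borel T) R _ h) => // n; case: (bh n).
exists B => z Sz; apply: (cvgr_to_le (cvg_norm (hf z Sz))).
by apply: nearW => n; exact: hB.
Qed.

Lemma bounded_measurable_indic (A : set (borel T)) : measurable A ->
  bounded_measurable \1_A.
Proof.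
move=> mA; split; first by apply: measurable_funTS; exact: measurable_indic.
by exists 1 => w _; rewrite indicE; case: (_ \in _); rewrite ?normr1 ?normr0.
Qed.

(* [exponential_prob lambda] is a measure only for [lambda > 0], hence an abstract
   [P], later identified with it. *)
Variable P : probability (measurableTypeR R) R.
Hypothesis P_nonneg : P `[0%R, +oo[%classic = 1%E.
Local Notation Rp := (`[0%R, +oo[%classic : set R).

Definition transition (f : T -> R) (z : T) : R :=
  \int[P]_(u in Rp) next_regime_mean f z.2 (Phi z.2 u z.1).

(** f is Borel on M * E only, so each summand is factored through the curve [g], which is continuous
    in u and stays in M * E for u >= 0. *)
Lemma next_regime_mean_measurable (f : T -> R) i x : bounded_measurable f -> M x ->
  measurable_fun Rp (fun u => next_regime_mean f i (Phi i u x)).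
Proof.
move=> [mf _] Mx; apply: measurable_sum => j.
pose g (u : R) : borel T := (Phi i u x, j).
pose h (w : borel T) := q w.1 i w.2 * f w.
have -> : (fun u => q (Phi i u x) i j * f (Phi i u x, j)) = h \o g by [].
apply: (@measurable_comp _ _ _ _ _ _ (S : set (borel T))).
- exact: product_space_measurable.
- move=> _ [u u0 <-]; split => //=; apply: M_invariant => //.
  by move: u0; rewrite /= in_itv/= andbT.
- apply: measurable_funM => //; apply: within_continuous_measurable.
    exact: product_space_closed.
  by apply/within_product_space => k; exact: jump_prob_continuous.
- have cg : continuous (fun u => (Phi i u x, j) : T).
    move=> u A [[U V] [/= /Phi_time_continuous xU jV] UV].
    have xU' : nbhs u (fun v => U (Phi i v x)) by [].
    change (nbhs u (fun v => A ((Phi i v x, j) : T))).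
    by apply: filterS xU' => v Uv; apply: UV; split => //=; exact: nbhs_singleton jV.
  exact: continuous_borel cg.
Qed.

Lemma next_regime_mean_integrable (f : T -> R) z : bounded_measurable f -> S z ->
  P.-integrable Rp (EFin \o (fun u => next_regime_mean f z.2 (Phi z.2 u z.1))).
Proof.
move=> bf [/= Mz _]; have [_ [B fB]] := bf.
apply: (@bounded_integrable _ _ _ P Rp _ _ B) => //.
  exact: next_regime_mean_measurable.
move=> u; rewrite /= in_itv/= andbT => u0.
by apply: next_regime_mean_bound => //; exact: M_invariant.
Qed.

Lemma transition_cst c z : transition (fun=> c) z = c.
Proof.
rewrite /transition /next_regime_mean.
under eq_Rintegral do rewrite -mulr_suml jump_prob_sum mul1r.
rewrite Rintegral_cst//; have -> : fine (P Rp) = 1 by rewrite P_nonneg.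
by rewrite mulr1.
Qed.

Lemma transitionD (f g : T -> R) z : bounded_measurable f -> bounded_measurable g ->
  S z -> transition (fun w => f w + g w) z = transition f z + transition g z.
Proof.
move=> bf bg Sz; rewrite -RintegralD//; try exact: next_regime_mean_integrable.
apply: eq_Rintegral => u _; rewrite -big_split/=.
by apply: eq_bigr => j _; rewrite mulrDr.
Qed.

Lemma transitionZ c (f : T -> R) z : bounded_measurable f ->
  S z -> transition (fun w => c * f w) z = c * transition f z.
Proof.
move=> bf Sz; rewrite -RintegralZl//; try exact: next_regime_mean_integrable.
by apply: eq_Rintegral => u _; rewrite mulr_sumr; apply: eq_bigr => j _; rewrite mulrCA.
Qed.

Lemma transitionN (f : T -> R) z : bounded_measurable f ->
  S z -> transition (fun w => - f w) z = - transition f z.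
Proof.
move=> bf Sz; rewrite -mulN1r -transitionZ//.
by congr transition; apply/funext => w; rewrite mulN1r.
Qed.

Lemma transition_le (f g : T -> R) z : bounded_measurable f -> bounded_measurable g ->
  (forall w, S w -> f w <= g w) -> S z -> transition f z <= transition g z.
Proof.
move=> bf bg fg Sz; apply: le_Rintegral => //; try exact: next_regime_mean_integrable.
move=> u; rewrite /= in_itv/= andbT => u0.
have MPhi : M (Phi z.2 u z.1) by apply: M_invariant => //; case: Sz.
by apply: ler_sum => j _; rewrite ler_wpM2l ?jump_prob_ge0// fg.
Qed.

Lemma transition_bound (f : T -> R) B z : bounded_measurable f ->
  (forall w, S w -> `|f w| <= B) -> S z -> `|transition f z| <= B.
Proof.
move=> bf fB Sz; have bm c : bounded_measurable (fun=> c).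
  by apply: bounded_measurable_continuous; exact: within_cst.
rewrite ler_norml -(transition_cst (- B) z) -{2}(transition_cst B z).
by apply/andP; split; apply: transition_le => // w /fB; rewrite ler_norml => /andP[].
Qed.

Lemma transition_cvg (h : nat -> T -> R) (f : T -> R) B z :
  (forall n, bounded_measurable (h n)) ->
  (forall n w, S w -> `|h n w| <= B) ->
  (forall w, S w -> h ^~ w @ \oo --> f w) -> S z ->
  transition (h n) z @[n --> \oo] --> transition f z.
Proof.
move=> bh hB hf Sz; apply: (@bounded_cvg_Rintegral _ _ _ P Rp _ _ _ B) => //.
- by move=> n; apply: next_regime_mean_measurable => //; case: Sz.
- move=> n u; rewrite /= in_itv/= andbT => u0.
  apply: next_regime_mean_bound; first exact: hB.
  by apply: M_invariant => //; case: Sz.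
- move=> u; rewrite /= in_itv/= andbT => u0; apply: cvg_finite_sum => j _.
  apply: cvgM; first exact: cvg_cst.
  by apply: hf; split => //; apply: M_invariant => //; case: Sz.
Qed.

(** For each holding time t the flow is continuous in the initial point; bounded convergence then
    passes to the limit under the integral over t. *)
Lemma transition_feller (f : T -> R) :
  {within S, continuous f} -> {within S, continuous (transition f)}.
Proof.
move=> cf; have bf := bounded_measurable_continuous cf.
have [_ [B fB]] := bf.
apply/within_product_space => i; apply: within_continuous_seq => x u Mx Mu ux.
apply: (@bounded_cvg_Rintegral _ _ _ P Rp _ _ _ B) => //.
- by move=> n; apply: next_regime_mean_measurable => //; exact: Mu.
- move=> n t; rewrite /= in_itv/= andbT => t0; apply: next_regime_mean_bound => //.
  exact: M_invariant.
- move=> t; rewrite /= in_itv/= andbT => t0.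
  have cg := @next_regime_mean_continuous f i cf.
  (* Continuity is relative to M, so convergence has to be stated in the filter of neighbourhoods
     within M, before and after the flow. *)
  have wu : u @ \oo --> within M (nbhs x).
    by move=> A /ux[N _ hN]; exists N => // n /hN; apply; exact: Mu.
  have Phiu : Phi i t (u n) @[n --> \oo] --> within M (nbhs (Phi i t x)).
    have /subspace_continuousP/(_ x Mx) Phix := @Phi_continuous i t t0.
    by move=> A /Phix/wu[N _ hN]; exists N => // n /hN; apply; exact: M_invariant.
  apply: cvg_comp Phiu _.
  have /subspace_continuousP := cg; apply; exact: M_invariant.
Qed.

Lemma chain_kernelE (z : T) (A : set (borel T)) :
  P = exponential_prob lambda :> (set R -> \bar R) -> measurable A -> S z ->
  chain_kernel Phi rate lambda z A = (transition \1_A z)%:E.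
Proof.
move=> PE mA Sz; rewrite /chain_kernel -PE /transition /Rintegral fineK//.
apply: integrable_fin_num => //; apply: next_regime_mean_integrable => //.
exact: bounded_measurable_indic.
Qed.

Lemma transition_indic_measurable (A : set (borel T)) : measurable A ->
  measurable_fun (S : set (borel T)) (transition \1_A).
Proof.
(* Measurability and boundedness of f travel along, since linearity and convergence of [transition]
   depend on them. *)
pose H f := bounded_measurable f /\ measurable_fun (S : set (borel T)) (transition f).
move=> mA; suff [] : H \1_A by [].
apply: (@indicator_induction R T open_state_cozero H) => //.
- move=> f cf f01.
  have cSf : {within S, continuous f} by exact: continuous_subspaceT.
  split; first exact: bounded_measurable_continuous.
  apply: within_continuous_measurable product_space_closed _.
  exact: transition_feller.
- move=> f g [bf mf] [bg mg]; split; first exact: bounded_measurableD.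
  apply: (@eq_measurable_fun _ _ (borel T) R _
    (fun z => transition f z + transition g z)).
    by move=> z /set_mem Sz; rewrite transitionD.
  exact: measurable_funD.
- move=> f [bf mf]; split; first exact: bounded_measurableN.
  apply: (@eq_measurable_fun _ _ (borel T) R _ (fun z => - transition f z)).
    by move=> z /set_mem Sz; rewrite transitionN.
  exact: measurableT_comp.
- move=> h f Hh h01 hf.
  have h1 n z : S z -> `|h n z| <= 1.
    by move=> _; have /andP[? ?] := h01 n z; rewrite ger0_norm.
  split; first by apply: (bounded_measurable_cvg _ h1) => // n; case: (Hh n).
  apply: (@measurable_fun_cvg _ (borel T) R _ (fun n => transition (h n))) => [n|z Sz].
    by case: (Hh n).
  by apply: (transition_cvg _ h1) => // n; case: (Hh n).
Qed.

Lemma transition_eq (f g : T -> R) z : (forall w, S w -> f w = g w) -> S z ->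
  transition f z = transition g z.
Proof.
move=> fg [/= Mz _]; apply: eq_Rintegral => u; rewrite inE /= in_itv/= andbT => u0.
by apply: eq_bigr => j _; rewrite fg//; split => //=; exact: M_invariant.
Qed.

(** * Existence of invariant probabilities *)

Section iterates.
Local Notation power k f := (iter k transition f).

Lemma iter_transition_continuous k (f : T -> R) : {within S, continuous f} ->
  {within S, continuous (power k f)}.
Proof. by move=> cf; elim: k => //= k; exact: transition_feller. Qed.

Let power_bm k (f : T -> R) : {within S, continuous f} -> bounded_measurable (power k f).
Proof.
by move=> cf; apply: bounded_measurable_continuous; exact: iter_transition_continuous.
Qed.

Lemma iter_transition_bound k (f : T -> R) B z : {within S, continuous f} ->
  (forall w, S w -> `|f w| <= B) -> S z -> `|power k f z| <= B.
Proof.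
move=> cf fB; elim: k z => [|k IHk] z Sz /=; first exact: fB.
by apply: transition_bound => //; exact: power_bm.
Qed.

Lemma iter_transition_cst k c z : S z -> power k (fun=> c) z = c.
Proof.
elim: k z => [//|k IHk] z Sz /=.
by rewrite (@transition_eq _ (fun=> c))// transition_cst.
Qed.

Lemma iter_transitionD k (f g : T -> R) z : {within S, continuous f} ->
  {within S, continuous g} -> S z ->
  power k (fun w => f w + g w) z = power k f z + power k g z.
Proof.
move=> cf cg; elim: k z => [//|k IHk] z Sz /=.
rewrite (@transition_eq _ (fun w => power k f w + power k g w))// transitionD//;
  exact: power_bm.
Qed.

Lemma iter_transitionZ k c (f : T -> R) z : {within S, continuous f} -> S z ->
  power k (fun w => c * f w) z = c * power k f z.
Proof.
move=> cf; elim: k z => [//|k IHk] z Sz /=.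
rewrite (@transition_eq _ (fun w => c * power k f w))// transitionZ//; exact: power_bm.
Qed.

Lemma iter_transition_le k (f g : T -> R) z : {within S, continuous f} ->
  {within S, continuous g} -> (forall w, S w -> f w <= g w) -> S z ->
  power k f z <= power k g z.
Proof.
move=> cf cg fg; elim: k z => [|k IHk] z Sz /=; first exact: fg.
by apply: transition_le => //; exact: power_bm.
Qed.

End iterates.

Section krylov_bogoliubov.
Variable z0 : T.
Hypothesis Sz0 : S z0.

Let cesaro (f : T -> R) (n : nat) : R :=
  n.+1%:R^-1 * \sum_(k < n.+1) iter k transition f z0.

Let cesaro_bound (f : T -> R) B n : {within S, continuous f} ->
  (forall w, S w -> `|f w| <= B) -> `|cesaro f n| <= B.
Proof.
move=> cf fB; rewrite normrM ger0_norm ?invr_ge0// ler_pdivrMl ?ltr0n//.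
rewrite (le_trans (ler_norm_sum _ _ _))//.
rewrite mulr_natl -[in leRHS](card_ord n.+1) -sumr_const; apply: ler_sum => k _.
exact: iter_transition_bound.
Qed.

(* Along an ultrafilter the Cesaro means of all continuous functions converge
   simultaneously, which makes the limit linear. *)
Variable U : set_system nat.
Hypothesis U_ultra : UltraFilter U.
Let U_proper : ProperFilter U.
Proof. exact: ultra_proper. Qed.

Hypothesis U_infty : \oo `<=` U.

Let mean (f : T -> R) : R := lim (cesaro f @ U).

(** The means stay in the compact segment [-B, B], where the image ultrafilter converges; [mean f]
    is thus a genuine limit and not the default value of [lim]. *)
Let cesaro_cvg (f : T -> R) : {within S, continuous f} -> cesaro f @ U --> mean f.
Proof.
move=> cf; have [_ [B fB]] := bounded_measurable_continuous cf.
have := @segment_compact R (- B) B; rewrite compact_ultra.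
move=> /(_ (cesaro f @ U) (ultra_fmap _ U_ultra))[|l [_ fl]]; last first.
  by rewrite /mean (cvg_lim _ fl).
change (U (fun n => `[- B, B]%classic (cesaro f n))); apply: filterE => n.
by rewrite /= in_itv/= -ler_norml; exact: cesaro_bound.
Qed.

Let meanD (f g : T -> R) : {within S, continuous f} -> {within S, continuous g} ->
  mean (fun z => f z + g z) = mean f + mean g.
Proof.
move=> cf cg; apply/cvg_lim => //.
have -> : cesaro (fun z => f z + g z) = (fun n => cesaro f n + cesaro g n).
  apply/funext => n; rewrite /cesaro -mulrDr -big_split/=; congr (_ * _).
  by apply: eq_bigr => k _; rewrite iter_transitionD.
by apply: cvgD; exact: cesaro_cvg.
Qed.

Let meanZ c (f : T -> R) : {within S, continuous f} ->
  mean (fun z => c * f z) = c * mean f.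
Proof.
move=> cf; apply/cvg_lim => //.
have -> : cesaro (fun z => c * f z) = (fun n => c * cesaro f n).
  apply/funext => n; rewrite /cesaro [RHS]mulrCA; congr (_ * _); rewrite mulr_sumr.
  by apply: eq_bigr => k _; rewrite iter_transitionZ.
by apply: cvgM; [exact: cvg_cst|exact: cesaro_cvg].
Qed.

Let mean_le (f g : T -> R) : {within S, continuous f} -> {within S, continuous g} ->
  (forall z, S z -> f z <= g z) -> mean f <= mean g.
Proof.
move=> cf cg fg; rewrite -subr_ge0.
have c : (fun n => cesaro g n - cesaro f n) @ U --> mean g - mean f.
  by apply: cvgB; exact: cesaro_cvg.
apply: (cvgr_to_ge c).
apply: filterE => n; rewrite subr_ge0 ler_wpM2l ?invr_ge0//.
by apply: ler_sum => k _; exact: iter_transition_le.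
Qed.

Let mean1 : mean (fun=> 1) = 1.
Proof.
apply/cvg_lim => //; apply: cvg_near_cst; apply: filterE => n.
rewrite /cesaro (eq_bigr (fun=> 1)) => [|k _]; last by rewrite iter_transition_cst.
by rewrite sumr_const card_ord mulVf// pnatr_eq0.
Qed.

(** The Cesaro means of [transition f] and of f differ by a telescoping sum of size at most 2 B / (n
    + 1), which vanishes along [\oo] and therefore along the finer U. *)
Let mean_transition (f : T -> R) : {within S, continuous f} ->
  mean (transition f) = mean f.
Proof.
move=> cf; apply/eqP; rewrite -subr_eq0; apply/eqP.
have ct := transition_feller cf.
have dl : (fun n => cesaro (transition f) n - cesaro f n) @ U -->
    mean (transition f) - mean f.
  by apply: cvgB; exact: cesaro_cvg.
suff d0 : (fun n => cesaro (transition f) n - cesaro f n) @ U --> (0 : R).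
  exact: (cvg_unique (@Rhausdorff R) dl d0).
apply: cvg_trans (_ : (fun n => cesaro (transition f) n - cesaro f n) @ \oo --> (0 : R)).
  by move=> A; exact: U_infty.
have [_ [B fB]] := bounded_measurable_continuous cf.
have dB n : `|cesaro (transition f) n - cesaro f n| <= (2 * B) * n.+1%:R^-1.
  rewrite /cesaro -mulrBr normrM [leRHS]mulrC ger0_norm ?invr_ge0//.
  rewrite ler_wpM2l ?invr_ge0//.
  rewrite (eq_bigr (fun k : 'I_n.+1 => iter k.+1 transition f z0)); last first.
    by move=> k _; rewrite iterSr.
  rewrite -sumrB -(big_mkord xpredT
    (fun k => iter k.+1 transition f z0 - iter k transition f z0)).
  rewrite telescope_sumr// (le_trans (ler_normB _ _))// mulr_natl mulr2n.
  by rewrite lerD//; [exact: iter_transition_bound|exact: fB].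
apply: norm_cvg0; apply: (@squeeze_cvgr _ _ _ _ (fun=> 0)
  (fun n => (2 * B) * n.+1%:R^-1)).
- by apply: nearW => n; rewrite normr_ge0 dB.
- exact: cvg_cst.
- rewrite -(mulr0 (2 * B)); apply: cvgM; first exact: cvg_cst.
  exact: cvg_harmonic.
Qed.

Lemma krylov_bogoliubov_ultra :
  P = exponential_prob lambda :> (set R -> \bar R) ->
  exists mu, invariant_prob Phi M rate lambda mu.
Proof.
move=> PE.
have [mu [muS muf]] := riesz_representation product_space_compact
  product_space_closed open_state_cozero meanD meanZ mean_le mean1.
have mS := product_space_measurable.
exists mu; split => // A mA.
(* On continuous functions this is [mean_transition] read through Riesz; the class [H] extends it to
   indicators. *)
have inv : \int[mu]_(z in S) \1_A z = \int[mu]_(z in S) transition \1_A z.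
  pose H f := [/\ bounded_measurable f,
    measurable_fun (S : set (borel T)) (transition f) &
    \int[mu]_(z in (S : set (borel T))) f z =
    \int[mu]_(z in (S : set (borel T))) transition f z].
  suff [] : H \1_A by [].
  have int f : bounded_measurable f -> mu.-integrable (S : set (borel T)) (EFin \o f).
    by move=> [mf [B fB]]; apply: (bounded_integrable mu mS mf fB).
  have bmt f : bounded_measurable f ->
      measurable_fun (S : set (borel T)) (transition f) ->
      bounded_measurable (transition f).
    move=> bf mf; split => //; case: (bf) => _ [B fB].
    by exists B => z Sz; exact: transition_bound.
  apply: (@indicator_induction R T open_state_cozero H) mA.
  - move=> f cf f01.
    have cSf : {within S, continuous f} by exact: continuous_subspaceT.
    have ct := transition_feller cSf.
    have bf := bounded_measurable_continuous cSf.
    split => //; first exact: within_continuous_measurable product_space_closed ct.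
    rewrite /Rintegral muf// muf ?mean_transition// => z Sz.
    (* [muf] covers functions valued in [0, 1]; [transition f] is one by comparison with the
       constants. *)
    rewrite -[0](transition_cst 0 z) -[in X in _ && X](transition_cst 1 z).
    have bc c : bounded_measurable (fun=> c).
      by apply: bounded_measurable_continuous; exact: within_cst.
    by apply/andP; split; apply: transition_le => // w _; have /andP[] := f01 w.
  - move=> f g [bf mf If] [bg mg Ig]; split; first exact: bounded_measurableD.
      apply: (@eq_measurable_fun _ _ (borel T) R _
    (fun z => transition f z + transition g z)).
        by move=> z /set_mem Sz; rewrite transitionD.
      exact: measurable_funD.
    rewrite (RintegralD mS (int f bf) (int g bg)) If Ig.
    rewrite -(RintegralD mS (int _ (bmt f bf mf)) (int _ (bmt g bg mg))).
    by apply: eq_Rintegral => z /set_mem Sz; rewrite transitionD.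
  - move=> f [bf mf If]; split; first exact: bounded_measurableN.
      apply: (@eq_measurable_fun _ _ (borel T) R _ (fun z => - transition f z)).
        by move=> z /set_mem Sz; rewrite transitionN.
      exact: measurableT_comp.
    have -> : \int[mu]_(z in (S : set (borel T))) - f z =
        \int[mu]_(z in (S : set (borel T))) (-1 * f z).
      by apply: eq_Rintegral => z _; rewrite mulN1r.
    rewrite (RintegralZl _ mS (int f bf)) If -(RintegralZl _ mS (int _ (bmt f bf mf))).
    by apply: eq_Rintegral => z /set_mem Sz; rewrite transitionN// mulN1r.
  - move=> h f Hh h01 hf.
    have h1 n z : S z -> `|h n z| <= 1.
      by move=> _; have /andP[? ?] := h01 n z; rewrite ger0_norm.
    have bh n : bounded_measurable (h n) by case: (Hh n).
    have mh n : measurable_fun (S : set (borel T)) (transition (h n)) by case: (Hh n).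
    have thf z : S z -> transition (h n) z @[n --> \oo] --> transition f z.
      by move=> Sz; exact: (transition_cvg bh h1).
    split; first exact: (bounded_measurable_cvg bh h1).
      exact: (@measurable_fun_cvg _ (borel T) R _ (fun n => transition (h n))).
    have c1 := @bounded_cvg_Rintegral _ (borel T) R mu S mS h f 1
      (fun n => (bh n).1) h1 (fun z _ => hf z).
    have c2 := @bounded_cvg_Rintegral _ (borel T) R mu S mS (fun n => transition (h n))
      (transition f) 1 mh (fun n z Sz => transition_bound (bh n) (h1 n) Sz) thf.
    apply: (cvg_unique (@Rhausdorff R) c1).
    rewrite (_ : (fun n => _) =
        (fun n => \int[mu]_(z in (S : set (borel T))) transition (h n) z)) //.
    by apply/funext => n; case: (Hh n).
have bA := bounded_measurable_indic mA.
have bt : bounded_measurable (transition \1_A).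
  split; first exact: transition_indic_measurable.
  by case: (bA) => _ [B AB]; exists B => z Sz; exact: transition_bound.
rewrite (eq_integral (fun z : borel T => (transition \1_A z)%:E)); last first.
  by move=> z /set_mem Sz; rewrite chain_kernelE.
have int (f : T -> R) : bounded_measurable f ->
    (\int[mu]_(z in S) (f z)%:E = (\int[mu]_(z in S) f z)%:E)%E.
  move=> [mf [B fB]]; rewrite /Rintegral fineK//.
  by apply: integrable_fin_num => //; exact: (bounded_integrable mu mS mf fB).
rewrite [RHS](int _ bt) -inv -(int _ bA) integral_indic//.
exact/esym/full_measureI.
Qed.

End krylov_bogoliubov.

(** M is a variable here: the theorem is later applied to closed subsets of the given compact set
    that are stable under the flows. *)
Theorem krylov_bogoliubov : M !=set0 ->
  P = exponential_prob lambda :> (set R -> \bar R) ->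
  exists mu, invariant_prob Phi M rate lambda mu.
Proof.
move=> [x Mx] PE.
have [U [U_ultra U_infty]] := ultraFilterLemma (@eventually_filter).
have Sz : S (x, point) by [].
exact: (krylov_bogoliubov_ultra Sz U_ultra U_infty PE).
Qed.

(** * Supports of invariant probabilities *)

Section support.
Hypothesis P_exponential : P = exponential_prob lambda :> (set R -> \bar R).
Hypothesis P_itv : forall a b, 0 <= a -> a < b -> (0 < P `[a, b]%classic)%E.
Hypothesis Phi0 : forall i x, Phi i 0 x = x.
Hypothesis rate_irreducible : forall x, M x -> irreducible_rates (rate x).

(** An exact holding time u has probability zero, but by continuity in time the mean stays above
    half its value on [u, u + e/2], an interval of positive probability. It lies to the right of u
    so that u = 0 is allowed. *)
Lemma transition_gt0 (f : T -> R) z u j : {within S, continuous f} ->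
  (forall w, S w -> 0 <= f w) -> S z -> 0 <= u ->
  0 < q (Phi z.2 u z.1) z.2 j -> 0 < f (Phi z.2 u z.1, j) -> 0 < transition f z.
Proof.
move=> cf f0 Sz u0 qj fj; have [/= Mz _] := Sz.
have bf := bounded_measurable_continuous cf.
pose g v := next_regime_mean f z.2 (Phi z.2 v z.1).
have MPhi v : 0 <= v -> M (Phi z.2 v z.1) by move=> v0; exact: M_invariant.
have g0 v : 0 <= v -> 0 <= g v.
  by move=> /MPhi Mv; apply: sumr_ge0 => k _; rewrite mulr_ge0 ?jump_prob_ge0 ?f0.
have gu : 0 < g u.
  rewrite /g /next_regime_mean (bigD1 j)//= ltr_pwDl ?mulr_gt0//.
  by have Mu := MPhi u u0; apply: sumr_ge0 => k _; rewrite mulr_ge0 ?jump_prob_ge0 ?f0.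
have [e e0 ge] : exists2 e, 0 < e & forall v, u <= v -> v < u + e -> g u / 2 < g v.
  have /subspace_continuousP/(_ _ (MPhi u u0)) := @next_regime_mean_continuous f z.2 cf.
  move=> /cvgrPdist_lt/(_ (g u / 2)); rewrite divr_gt0// => /(_ isT) gnear.
  have /nbhs_ballP[e /= e0 he] := Phi_time_continuous gnear.
  exists e => // v uv ve.
  have /he/= : ball u e v by rewrite -ball_normE /= distrC ger0_norm ?subr_ge0// ltrBlDl.
  move=> /(_ (MPhi v (le_trans u0 uv))) guv.
  have {guv} : g u - g v < g u / 2 := le_lt_trans (ler_norm _) guv.
  by lra.
pose I : set R := `[u, u + e / 2]%classic.
have mI : measurable I by exact: measurable_itv.
have IRp : I `<=` Rp.
  by move=> v; rewrite /I /= !in_itv/= andbT => /andP[/(le_trans u0)].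
have PI : (0 < P I)%E by apply: P_itv => //; rewrite ltrDl divr_gt0.
have PIfin : P I \is a fin_num by apply: fin_num_measure.
have intI : P.-integrable Rp (EFin \o \1_I).
  apply: (@bounded_integrable _ _ _ P Rp _ _ 1) => //.
  by move=> v _; rewrite indicE; case: (_ \in _); rewrite ?normr1 ?normr0.
have intcI : P.-integrable Rp (EFin \o (fun v => g u / 2 * \1_I v)).
  rewrite (_ : _ \o _ = (fun v => (g u / 2)%:E * (EFin \o \1_I) v)%E)//.
  exact: integrableZl.
apply: (@lt_le_trans _ _ (\int[P]_(v in Rp) (g u / 2 * \1_I v))).
  rewrite RintegralZl// mulr_gt0 ?divr_gt0//.
  rewrite /Rintegral integral_indic// (_ : I `&` Rp = I); last exact/setIidPl.
  by rewrite fine_gt0// PI/= -ge0_fin_numE.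
apply: le_Rintegral => //; first exact: next_regime_mean_integrable.
move=> v; rewrite /= in_itv/= andbT => v0; rewrite indicE.
have [vI|vI] := boolP (v \in I); last by rewrite mulr0; exact: g0.
rewrite mulr1; apply/ltW/ge.
  by move: vI; rewrite inE /I /= in_itv/= => /andP[].
move: vI; rewrite inE /I /= in_itv/= => /andP[_ /le_lt_trans]; apply.
by rewrite ltrD2l ltr_pdivrMr// ltr_pMr// ltr1n.
Qed.

Lemma transition_ge0 (f : T -> R) z : (forall w, S w -> 0 <= f w) -> S z ->
  0 <= transition f z.
Proof.
move=> f0 [/= Mz _]; apply: Rintegral_ge0 => u; rewrite /= in_itv/= andbT => u0.
have MPhi : M (Phi z.2 u z.1) by exact: M_invariant.
by apply: sumr_ge0 => k _; rewrite mulr_ge0 ?jump_prob_ge0 ?f0.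
Qed.

(* [B] is either the whole space M * E, or its part outside Gamma * E, which will
   turn out to be negligible; [msupp] is the support of the restriction of [mu] to [B]. *)
Section subinvariant_set.
Variables (mu : probability (borel T) R) (B : set (borel T)).
Hypothesis measurableB : measurable B.
Hypothesis BS : B `<=` S.
Hypothesis B_subinvariant : forall A : set (borel T), measurable A ->
  (\int[mu]_(z in B) (transition \1_A z)%:E <= mu (A `&` B))%E.

Let msupp : set T := [set z | S z /\
  forall U : set T, open_nbhs z U -> (0 < mu (U `&` B))%E].

(** Below the indicator of a neighbourhood U of the target lies a continuous f with [transition f]
    positive at z, hence above some c > 0 on a neighbourhood N of z. Subinvariance then gives mu (U
    [&] B) >= c mu (N [&] B) > 0. *)
Lemma support_jump z u j : msupp z -> 0 <= u -> 0 < q (Phi z.2 u z.1) z.2 j ->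
  msupp (Phi z.2 u z.1, j).
Proof.
move=> [Sz zsupp] u0 qj; split=> [|U [oU Uz]].
  by split => //=; apply: M_invariant => //; case: Sz.
have [f0 [cf0 f0_ge0 U_f0]] := open_state_cozero oU.
pose f w := Num.min 1 (f0 w).
have cf : {within S, continuous f}.
  by apply: within_min; [exact: within_cst|exact: continuous_subspaceT].
have f_ge0 w : S w -> 0 <= f w by rewrite le_min ler01 f0_ge0.
have bf := bounded_measurable_continuous cf.
have mU : measurable (U : set (borel T)) by exact: sub_sigma_algebra.
have bU := bounded_measurable_indic mU.
have fU w : S w -> f w <= \1_U w.
  move=> _; rewrite indicE; have [Uw|Uw] := pselect (U w).
    by rewrite mem_set// ge_min lexx.
  rewrite memNset// ge_min; apply/orP; right; rewrite leNgt; apply/negP => fw.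
  by apply: Uw; rewrite U_f0.
have tf_gt0 : 0 < transition f z.
  apply: (transition_gt0 cf f_ge0 Sz u0 qj).
  by rewrite /f lt_min ltr01/=; move: Uz; rewrite U_f0.
pose c := transition f z / 2.
have c0 : 0 < c by rewrite divr_gt0.
(* [transition f] is continuous relative to S, so its superlevel set is only the trace on S of an
   open set. *)
have [N oN NS] : exists2 N : set T, open N &
    N `&` S = [set w | c < transition f w] `&` S.
  apply/open_subspaceP.
  have := (continuousP _).1 (transition_feller cf) _ (@open_gt R c).
  by [].
have Nz : N z.
  suff [] : (N `&` S) z by [].
  rewrite NS; split=> //=; rewrite /c ltr_pdivrMr// ltr_pMr// ltr1n//.
have mN : measurable (N : set (borel T)) by exact: sub_sigma_algebra.
have muN : (0 < mu (N `&` B))%E by exact: zsupp.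
apply: (lt_le_trans _ (B_subinvariant mU)).
apply: (@lt_le_trans _ _ (\int[mu]_(w in B) (c%:E * (\1_N w)%:E))%E).
  rewrite ge0_integralZl//; last by rewrite lee_fin ltW.
    by rewrite integral_indic// mule_gt0// lte_fin.
  apply/measurable_EFinP; apply: measurable_funTS; exact: measurable_indic.
apply: ge0_le_integral => //.
- by move=> w _; rewrite mule_ge0 ?lee_fin// ltW.
- apply: measurable_funeM; apply/measurable_EFinP.
  by apply: measurable_funTS; exact: measurable_indic.
- apply/measurable_EFinP; apply: (measurable_funS product_space_measurable BS).
  exact: transition_indic_measurable.
- move=> w /BS Sw; rewrite -EFinM lee_fin indicE.
  have [Nw|Nw] := pselect (N w); last first.
    rewrite memNset// mulr0; exact: transition_ge0.
  rewrite mem_set// mulr1; apply: (@le_trans _ _ (transition f w)).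
    have : (N `&` S) w by [].
    by rewrite NS => -[/ltW].
  exact: transition_le.
Qed.

Lemma support_switch x i j : msupp (x, i) -> msupp (x, j).
Proof.
move=> xi; have [[/= Mx _] _] := xi.
have /connectP[p ep ->] := rate_irreducible Mx i j.
elim: p i xi ep => [//|k p IHp] i xi /= /andP[rik pk]; apply: IHp pk.
have [->//|ki] := eqVneq k i.
have := @support_jump (x, i) 0 k xi (lexx _); rewrite /= Phi0; apply.
exact: jump_prob_gt0.
Qed.

Lemma support_flow x i u : msupp (x, i) -> 0 <= u -> msupp (Phi i u x, i).
Proof.
move=> xi u0; apply: (@support_jump (x, i)) => //=.
by apply: jump_prob_diag_gt0; apply: M_invariant => //; case: xi => -[].
Qed.

Lemma support_foldl x (s : seq (E * R)) i j :
  msupp (x, i) -> all (fun iu => 0 <= iu.2) s ->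
  msupp (foldl (fun y iu => Phi iu.1 iu.2 y) x s, j).
Proof.
elim: s x i => [|[k u] s IHs] x i xi /=; first by move=> _; exact: support_switch xi.
move=> /andP[u0 s0]; apply: (IHs _ k) => //; apply: support_flow => //.
exact: support_switch xi.
Qed.

Lemma support_accessible x i : msupp (x, i) ->
  accessible_set Phi M `*` setT `<=` msupp.
Proof.
move=> xi [y j] [/= Gy _]; have [[/= Mx _] _] := xi.
have yx := Gy x Mx.
have path y' : gamma_plus Phi x y' -> msupp (y', j).
  move=> [n [k [u [n0 u0 ->]]]]; apply: (support_foldl _ xi).
  rewrite -(all_map snd (fun v => 0 <= v)).
  have -> : [seq iu.2 | iu <- zip k u] = u by apply: unzip2_zip; rewrite !size_tuple.
  exact/all_tnthP.
split.
  split => //=; have cM : closed M by apply: compact_closed => //; exact: norm_hausdorff.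
  apply: cM; apply: closureS yx => y' /path; by case => -[].
move=> U [oU Uy].
have [[V W] /= [yV jW] VW] := open_nbhs_nbhs (conj oU Uy).
have [y' [gy' Vy']] := yx V yV.
have [_] := path y' gy'; apply; split=> //; apply: VW; split=> //=.
exact: nbhs_singleton jW.
Qed.

(** The sets that contain B up to a negligible part form a proper filter, to which the compact S
    belongs; a cluster point has no neighbourhood whose trace on B is null. *)
Lemma support_nonempty : (0 < mu B)%E -> exists z, msupp z.
Proof.
move=> B0.
pose F := [set A : set T | mu.-negligible (B `&` ~` A)].
have FF : ProperFilter F.
  split; last first.
    split.
    - by rewrite /F /= setCT setI0; exact: negligible_set0.
    - by move=> A C FA FC; rewrite /F/= setCI setIUr; exact: negligibleU.
    - move=> A C AC; apply: negligibleS; apply: setIS; exact: subsetC.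
  rewrite /F/= setC0 setIT => /negligibleP -/(_ measurableB) muB.
  by rewrite muB ltxx in B0.
have FS : F S.
  rewrite /F/= (_ : B `&` ~` S = set0); first exact: negligible_set0.
  by apply/disjoints_subset; rewrite setCK.
have [z [Sz zF]] := product_space_compact FF FS.
exists z; split=> // U [oU Uz].
have mU : measurable (U : set (borel T)) by exact: sub_sigma_algebra.
rewrite lt_neqAle measure_ge0 andbT; apply/negP => /eqP U0.
have [|w [+ Uw]] := zF (~` U) U _ (open_nbhs_nbhs (conj oU Uz)); last by apply.
by rewrite /F/= setCK; apply/negligibleP; [exact: measurableI|rewrite setIC].
Qed.

End subinvariant_set.

(** * Sets stable under the flows, and the mass of the accessible set *)

Section accessibility.

Lemma gamma_plus_flow x y k t : gamma_plus Phi x y -> 0 <= t ->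
  gamma_plus Phi x (Phi k t y).
Proof.
move=> [n [i [u [n0 u0 ->]]]] t0; exists n.+1.
have si : size (rcons (rcons (take n i) k) point) == n.+2.
  by rewrite !size_rcons size_take size_tuple ltnSn.
exists (Tuple si), [tuple of rcons u t]; split=> // [j|].
  apply/all_tnthP: j; rewrite all_rcons t0/=; exact/all_tnthP.
rewrite /composite_flow /= -[rcons (rcons _ k) _]cats1 -[in RHS](cats0 (rcons u t)).
have sn : size (take n i) = size u by rewrite size_take !size_tuple ltnSn.
rewrite zip_cat ?size_rcons ?sn// cats0 zip_rcons// foldl_rcons.
congr (Phi k t (foldl _ x _)).
rewrite -{1}(cat_take_drop n i) -{1}(cats0 (u : seq R)) zip_cat//.
by case: (drop n i) => [|? ?]; rewrite cats0.
Qed.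

Lemma gamma_plus_sub x : M x -> gamma_plus Phi x `<=` M.
Proof.
move=> Mx y [n [i [u [_ u0 ->]]]]; rewrite /composite_flow.
have : all (fun iu => 0 <= iu.2) (zip i u).
  rewrite -(all_map snd (fun v => 0 <= v)).
  have -> : [seq iu.2 | iu <- zip i u] = u by apply: unzip2_zip; rewrite !size_tuple.
  exact/all_tnthP.
elim: (zip i u) x Mx => [//|[k v] s IHs] x Mx /= /andP[v0 s0].
by apply: IHs => //; exact: M_invariant.
Qed.

Let closedM : closed M.
Proof. by apply: compact_closed => //; exact: norm_hausdorff. Qed.

Lemma closure_gamma_plus_sub x : M x -> closure (gamma_plus Phi x) `<=` M.
Proof. by move=> Mx y /(closureS (gamma_plus_sub Mx))/closedM. Qed.

Lemma closure_gamma_plus_neq0 x : closure (gamma_plus Phi x) !=set0.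
Proof.
exists x; apply: subset_closure.
exists 1, [tuple point; point], [tuple 0]; split => // [k|].
  by rewrite (tnth_nth 0) (ord1 k).
by rewrite /composite_flow /= Phi0.
Qed.

Lemma closure_gamma_plus_flow x k t y : M x -> 0 <= t ->
  closure (gamma_plus Phi x) y -> closure (gamma_plus Phi x) (Phi k t y).
Proof.
move=> Mx t0 yx U Uy.
have My := closure_gamma_plus_sub Mx yx.
have /subspace_continuousP/(_ y My U Uy) Unear := @Phi_continuous k t t0.
have [y' [gy' Uy']] := yx _ Unear.
exists (Phi k t y'); split; first exact: gamma_plus_flow.
by apply: Uy'; exact: gamma_plus_sub gy'.
Qed.

Local Notation Gamma := (accessible_set Phi M).

Lemma accessible_set_closed : closed Gamma.
Proof. by apply: closed_bigI => x _; exact: closed_closure. Qed.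

Lemma accessible_set_flow k t y : 0 <= t -> Gamma y -> Gamma (Phi k t y).
Proof. by move=> t0 Gy x Mx; apply: closure_gamma_plus_flow => //; exact: Gy. Qed.

Lemma chain_kernel_measurable (A : set (borel T)) : measurable A ->
  measurable_fun (S : set (borel T)) (fun z => chain_kernel Phi rate lambda z A).
Proof.
move=> mA; apply: (@eq_measurable_fun _ _ (borel T) (\bar R) _
    (fun z => (transition \1_A z)%:E)).
  by move=> z /set_mem Sz; rewrite chain_kernelE.
by apply/measurable_EFinP; exact: transition_indic_measurable.
Qed.

Lemma chain_kernel_ge0 (A : set (borel T)) z : measurable A -> S z ->
  (0 <= chain_kernel Phi rate lambda z A)%E.
Proof.
move=> mA Sz; rewrite chain_kernelE// lee_fin; exact: transition_ge0.
Qed.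

Section invariant_measure.
Variable mu : probability (borel T) R.
Hypothesis mu_invariant : invariant_prob Phi M rate lambda mu.
Let mS : measurable (S : set (borel T)) := product_space_measurable.

Lemma invariant_transition (A : set (borel T)) : measurable A ->
  (\int[mu]_(z in S) (transition \1_A z)%:E = mu A)%E.
Proof.
move=> mA; rewrite (mu_invariant.2 A mA); apply: eq_integral => z /set_mem Sz.
by rewrite chain_kernelE.
Qed.

Lemma accessible_set_sub_support : Gamma `*` setT `<=` msupport mu.
Proof.
have [muS _] := mu_invariant.
have sub (A : set (borel T)) : measurable A ->
    (\int[mu]_(z in S) (transition \1_A z)%:E <= mu (A `&` S))%E.
  by move=> mA; rewrite invariant_transition// full_measureI.
have [|[x i] xi] := support_nonempty mS (@subset_refl _ S) (mu := mu).
  by rewrite muS lte01.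
move=> z /(support_accessible mS (@subset_refl _ S) sub xi)[_ zsupp] U /[dup] /zsupp.
move=> US [oU _]; apply: lt_le_trans US _; rewrite le_measure ?inE//.
  by apply: measurableI => //; exact: sub_sigma_algebra.
exact: sub_sigma_algebra.
Qed.

(** The chain cannot leave Gamma * E, which therefore already sends itself its whole mass; by
    invariance nothing can enter it from the complement B, up to a null set. So B receives its mass
    from B alone, which is where subinvariance comes from. *)
Lemma accessible_set_full : Gamma° !=set0 -> mu (Gamma `*` setT) = 1%E.
Proof.
move=> [y Gy]; have [muS _] := mu_invariant.
have Gy' : Gamma y by exact: interior_subset.
have [x Mx] : M !=set0.
  apply/set0P/eqP => M0; move: muS; rewrite M0 set0X measure0.
  by move=> /eqP; rewrite eq_sym onee_eq0.
have GM : Gamma `<=` M by move=> w /(_ x Mx); exact: closure_gamma_plus_sub.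
pose G : set (borel T) := Gamma `*` setT.
have GS : G `<=` S by move=> z [/GM Mz _]; split.
have mG : measurable G.
  apply: closed_borel; have -> : G = fst @^-1` Gamma by apply/seteqP; split => [z []|z].
  by apply: closed_comp => // [z _|]; [exact: cvg_fst|exact: accessible_set_closed].
pose B : set (borel T) := S `\` G.
have mB : measurable B by exact: measurableD.
have BS : B `<=` S by move=> z [].
have SGB : S = G `|` B by apply/esym; apply: setDUK.
have GB0 : [disjoint G & B] by apply/disj_setPS => z [Gz []].
have mt (A D : set (borel T)) : D `<=` S -> measurable A ->
    measurable_fun D (fun z => (transition \1_A z)%:E).
  move=> DS mA; apply/measurable_EFinP; apply: (measurable_funS mS DS).
  exact: transition_indic_measurable.
have t_ge0 (A : set (borel T)) z : S z -> (0 <= (transition \1_A z)%:E)%E.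
  by move=> Sz; rewrite lee_fin; exact: transition_ge0.
have tG z : G z -> transition \1_G z = 1.
  move=> [Gz _]; rewrite -(transition_cst 1 z); apply: eq_Rintegral => u.
  rewrite inE /= in_itv/= andbT => u0; apply: eq_bigr => j _.
  by rewrite indicE mem_set//; split => //=; exact: accessible_set_flow.
have BG0 : (\int[mu]_(z in B) (transition \1_G z)%:E = 0)%E.
  (* By [tG], invariance reads mu G = mu G + the integral over B, and the finite mu G cancels. *)
  have := invariant_transition mG.
  rewrite SGB ge0_integral_setU//; last 2 first.
  - by rewrite -SGB; apply: mt.
  - by move=> z; rewrite -SGB; exact: t_ge0.
  rewrite (@eq_integral _ _ _ _ _ (cst 1%E)); last by move=> z /set_mem/tG ->.
  rewrite integral_cst// mul1e => e.
  have {e} : (mu G + \int[mu]_(z in B) (transition \1_G z)%:E = mu G)%E := e.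
  rewrite -(fineK (fin_num_measure mu G mG)); move: (fine (mu G)) => g.
  case: (integral _ _ _) => [r [e]|H|H]; [|by []|by []].
  by rewrite (_ : r = 0)//; move: e; lra.
have sub (A : set (borel T)) : measurable A ->
    (\int[mu]_(z in B) (transition \1_A z)%:E <= mu (A `&` B))%E.
  move=> mA; have mAB : measurable (A `&` B) by exact: measurableI.
  have bG := bounded_measurable_indic mG.
  have bAB := bounded_measurable_indic mAB.
  (* On S the indicator of A is at most that of A [&] B plus that of G, and the latter contributes
     nothing over B by [BG0]. *)
  apply: (@le_trans _ _ (\int[mu]_(z in B) ((transition \1_(A `&` B) z)%:E +
      (transition \1_G z)%:E))%E).
    apply: ge0_le_integral => //.
    - by move=> z /BS; exact: t_ge0.
    - exact: mt.
    - by apply: emeasurable_funD; exact: mt.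
    - move=> z /BS Sz; rewrite -EFinD lee_fin -transitionD//.
      apply: transition_le => //; first exact: bounded_measurable_indic.
        exact: bounded_measurableD.
      move=> w Sw; rewrite !indicE in_setI.
      have [Gw|Gw] := pselect (G w); last first.
        by rewrite (memNset Gw) addr0 (mem_set (conj Sw Gw : B w)) andbT.
      rewrite (mem_set Gw) -natrD ler_nat.
      by case: (w \in A); case: (w \in B).
  rewrite ge0_integralD//; last 4 first.
  - by move=> z /BS; exact: t_ge0.
  - exact: mt.
  - by move=> z /BS; exact: t_ge0.
  - exact: mt.
  rewrite BG0 adde0 -[leRHS]invariant_transition//.
  by apply: ge0_subset_integral => //; [exact: mt|exact: t_ge0].
have muB : mu B = 0%E.
  apply/eqP/negPn/negP => muB.
  have B0 : (0 < mu B)%E by rewrite lt_neqAle eq_sym muB measure_ge0.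
  have [[x' i] xi] := support_nonempty mB BS B0.
  have [_ ysupp] := support_accessible mB BS sub xi
    (conj Gy' I : (Gamma `*` setT) (y, point)).
  pose V : set T := Gamma° `*` setT.
  have VB : V `&` B = set0.
    by rewrite -subset0 => z [[/interior_subset Gz _] [_]]; apply.
  have : (0 < mu (V `&` B))%E; last by rewrite VB measure0 ltxx.
  apply: ysupp; split=> //.
  have -> : V = fst @^-1` Gamma° by apply/seteqP; split => [z []|z].
  by apply: open_comp => [z _|]; [exact: cvg_fst|exact: open_interior].
rewrite -muS (_ : M `*` setT = G `|` B :> set T)// measureU//; last exact/disj_set2P.
by rewrite [X in (_ + X)%E](_ : _ = 0%E) ?adde0.
Qed.

End invariant_measure.
End accessibility.
End support.

End chain.

(** * Exponential holding times and conclusion *)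

Lemma exponential_probability {R : realType} (lambda : R) : 0 < lambda ->
  exists P : probability (measurableTypeR R) R,
  [/\ P = exponential_prob lambda :> (set R -> \bar R),
      P `[0%R, +oo[%classic = 1%E &
      forall a b, 0 <= a -> a < b -> (0 < P `[a, b]%classic)%E].
Proof.
move=> l0; refine (ex_intro _ (exponential_prob lambda : probability _ R) _).
have pdf0 x := exponential_pdf_ge0 (ltW l0) x.
split=> //=; rewrite /exponential_prob.
  rewrite -(integral_exponential_pdf l0) integral_mkcond; apply: eq_integral => x _.
  rewrite /patch; case: ifPn => //; rewrite notin_setE/= in_itv/= andbT => /negP.
  by rewrite -ltNge => x0; rewrite lt0_exponential_pdf.
(* [c] is the value of the decreasing density at b, hence its minimum on [a, b]. *)
move=> a b a0 ab; pose c := lambda * expR (- lambda * b).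
have c0 : 0 < c by rewrite mulr_gt0 ?expR_gt0.
apply: (@lt_le_trans _ _ (\int[lebesgue_measure]_(x in `[a, b]) (cst c%:E) x)%E).
  rewrite integral_cst//= lebesgue_measure_itv/= lte_fin ab.
  by rewrite mule_gt0// lte_fin// subr_gt0.
apply: ge0_le_integral => //.
- by move=> x _; rewrite lee_fin ltW.
- apply/measurable_EFinP; apply: measurable_funTS; exact: measurable_exponential_pdf.
- move=> x; rewrite /= in_itv/= => /andP[ax xb].
  rewrite lee_fin exponential_pdfE ?(le_trans a0)// ler_wpM2l ?(ltW l0)//.
  by rewrite ler_expR !mulNr lerN2 ler_wpM2l ?(ltW l0).
Unshelve. exact: l0.
Qed.

Lemma support_sub_closed {R : realType} {T : ptopologicalType}
    (mu : probability (borel T) R) (C : set T) :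
  closed C -> mu C = 1%E -> msupport mu `<=` C.
Proof.
move=> cC muC z zsupp; apply: contrapT => Cz.
have := zsupp (~` C) (conj (closed_openC cC) Cz).
by rewrite probability_setC ?muC ?subee ?ltxx//; exact: closed_borel.
Qed.

Theorem proposition3p17 (R : realType) (d : nat) (hd : (1 <= d)%N)
  (E : pointedFinType)
  (F : E -> 'rV[R]_d -> 'rV[R]_d)
  (F_smooth : forall i, smooth (F i))
  (F_bounded : forall i, [bounded F i x | x in [set: 'rV[R]_d]])
  (Phi : E -> R -> 'rV[R]_d -> 'rV[R]_d)
  (Phi_flow : forall i, is_flow (F i) (Phi i))
  (M : set 'rV[R]_d)
  (M_compact : compact M)
  (M_nonempty : M !=set0)
  (M_invariant : forall i (t : R), 0 <= t -> Phi i t @` M `<=` M)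
  (rate : 'rV[R]_d -> E -> E -> R)
  (rate_continuous : forall i j, {within M, continuous (fun x => rate x i j)})
  (rate_ge0 : forall x i j, M x -> i != j -> 0 <= rate x i j)
  (rate_diag : forall x i, M x -> rate x i i = 0)
  (rate_irreducible : forall x, M x -> irreducible_rates (rate x))
  (lambda : R)
  (lambda_gt : forall x i, M x -> \sum_(j | j != i) rate x i j < lambda) :
  let Gamma := accessible_set Phi M in
  let P_inv := invariant_prob Phi M rate lambda in
  [/\ Gamma !=set0 ->
        (forall mu, P_inv mu -> Gamma `*` setT `<=` msupport mu) /\
        (exists mu, P_inv mu /\ msupport mu = Gamma `*` setT),
      Gamma° !=set0 ->
        forall mu, P_inv mu -> Gamma `*` setT = msupport mu
    & forall pi, is_unique_invariant_prob Phi M rate lambda pi ->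
        msupport pi = Gamma `*` setT].
Proof.
move=> Gamma P_inv.
have [x0 Mx0] := M_nonempty.
have lambda_gt0 : 0 < lambda.
  apply: le_lt_trans (lambda_gt x0 point Mx0); apply: sumr_ge0 => j ji.
  by rewrite rate_ge0// eq_sym.
have [P [PE P_nonneg P_itv]] := exponential_probability lambda_gt0.
have Phi0 i x : Phi i 0 x = x by have [] := Phi_flow i x.
have M_inv i t x : 0 <= t -> M x -> M (Phi i t x).
  by move=> t0 Mx; apply: (M_invariant i t t0); exists x.
have Phi_x i t : 0 <= t -> {within M, continuous (Phi i t)}.
  by apply: (flow_continuous (F_smooth i) (Phi_flow i) M_compact) => s; exact: M_invariant.
have Phi_t i x : continuous (Phi i ^~ x) by exact: flow_time_continuous (Phi_flow i).
have closedM : closed M by apply: compact_closed => //; exact: norm_hausdorff.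
have closedX (C : set 'rV[R]_d) : closed C -> closed (C `*` setT : set (state R d E)).
  move=> cC; have -> : C `*` setT = fst @^-1` C :> set (state R d E).
    by apply/seteqP; split => [z []|z].
  by apply: closed_comp => // z _; exact: cvg_fst.
(* Krylov-Bogoliubov is run with C in place of M; the result is invariant for the chain on M * E
   because the integral over M * E does not see the null set outside C * E. *)
have invariant_on (C : set 'rV[R]_d) : closed C -> C `<=` M -> C !=set0 ->
    (forall i t x, 0 <= t -> C x -> C (Phi i t x)) ->
    exists2 mu : probability (borel (state R d E)) R, P_inv mu & mu (C `*` setT) = 1%E.
  move=> cC CM C0 C_inv.
  have [|||||mu [muC mu_inv]] := @krylov_bogoliubov R d E Phi C _ _ Phi_t C_inv
    rate lambda _ _ _ P P_nonneg C0 PE.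
  - exact: subclosed_compact M_compact CM.
  - by move=> i t t0; apply: continuous_subspaceW CM _; exact: Phi_x.
  - by move=> i j; apply: continuous_subspaceW CM _; exact: rate_continuous.
  - by move=> x i j /CM; exact: rate_ge0.
  - by move=> x i /CM; exact: lambda_gt.
  have mC : measurable (C `*` setT : set (borel (state R d E))).
    by apply: closed_borel; exact: closedX.
  have mM : measurable (M `*` setT : set (borel (state R d E))).
    by apply: closed_borel; exact: closedX.
  have CMX : (C `*` setT : set (state R d E)) `<=` M `*` setT.
    by move=> z [/CM Mz _]; split.
  have muM : mu (M `*` setT) = 1%E.
    apply/eqP; rewrite eq_le probability_le1//= -muC.
    by apply: le_measure; rewrite ?inE.
  exists mu => //; split=> // A mA; rewrite mu_inv//.
  pose N : set (borel (state R d E)) := M `*` setT `\` C `*` setT.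
  have mN : measurable N by exact: measurableD.
  have muN : mu N = 0%E.
    apply/eqP; rewrite eq_le measure_ge0 andbT.
    have <- : mu (~` (C `*` setT)) = 0%E by rewrite probability_setC// muC subee.
    apply: le_measure; rewrite ?inE; [exact: mN|exact: measurableC|by move=> z []].
  rewrite (@ge0_negligible_integral _ _ _ mu (M `*` setT) N)//.
  - congr (integral mu _ _); rewrite /N setDD; exact/esym/setIidPr.
  - exact: (chain_kernel_measurable M_compact Phi_x Phi_t M_inv rate_continuous
      rate_ge0 lambda_gt PE).
  - by move=> z Mz; apply: (chain_kernel_ge0 M_compact Phi_t M_inv rate_continuous
      rate_ge0 lambda_gt PE).
have supp_ge mu : P_inv mu -> Gamma `*` setT `<=` msupport mu.
  exact: (accessible_set_sub_support M_compact Phi_x Phi_t M_inv rate_continuous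
    rate_ge0 lambda_gt PE P_itv Phi0 rate_irreducible).
have closedG : closed (Gamma `*` setT : set (state R d E)).
  by apply: closedX; exact: accessible_set_closed.
split.
- move=> G0; split=> //.
  have [| | |mu mu_inv muG] := invariant_on Gamma _ _ G0.
  + exact: accessible_set_closed.
  + by move=> y /(_ x0 Mx0); exact: closure_gamma_plus_sub.
  + by move=> i t y t0 Gy; exact: accessible_set_flow.
  exists mu; split=> //; apply/seteqP; split; last exact: supp_ge.
  exact: support_sub_closed.
- move=> G0 mu mu_inv; apply/seteqP; split; first exact: supp_ge.
  apply: (support_sub_closed closedG).
  exact: (accessible_set_full M_compact Phi_x Phi_t M_inv rate_continuous
    rate_ge0 lambda_gt P_nonneg PE P_itv Phi0 rate_irreducible).
- move=> pi [pi_inv pi_unique]; apply/seteqP; split; last exact: supp_ge.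
  move=> z pi_z; split=> // x Mx.
  have cx : closed (closure (gamma_plus Phi x)) by exact: closed_closure.
  (* By uniqueness the invariant probability carried by this closure is [pi], whose support thus
     lies over the closure for every x in M. *)
  have [| | |mu mu_inv muC] := invariant_on (closure (gamma_plus Phi x)) cx.
  + exact: (closure_gamma_plus_sub M_compact M_inv Mx).
  + exact: closure_gamma_plus_neq0.
  + by move=> i t y t0 gy; exact: (closure_gamma_plus_flow M_compact Phi_x M_inv Mx t0 gy).
  have piC : pi (closure (gamma_plus Phi x) `*` setT) = 1%E.
    by rewrite -(pi_unique _ mu_inv)//; apply: closed_borel; exact: closedX.
  by have [] := support_sub_closed (closedX _ cx) piC pi_z.
Qed.
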